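(* Let $\mathcal{D}=\{(x,t):\,0\le x<\infty,\ 0\le t<a\}$. Let a $p\times p$ matrix function $v\in C^1(\mathcal{D})$ have a continuous second partial derivative $v_{xx}$, and let $v_{xxx}$ exist. Assume that $v$ satisfies the matrix focusing mKdV equation $$4v_t=v_{xxx}+3\big(v_xv^*v+vv^*v_x\big)$$ on $\mathcal{D}$, and that for some $M>0$ $$\sup_{(x,t)\in\mathcal{D}}\|v(x,t)\|\le M,\qquad \sup_{(x,t)\in\mathcal{D}}\big(\|v_x(x,t)\|+\|v_{xx}(x,t)\|\big)<\infty .$$ For each $t\in[0,a)$ let $\varphi(t,z)$ ($\Im z<-M$) be the Weyl function of the skew-self-adjoint Dirac system $\frac{d}{dx}W(x,t,z)=G(x,t,z)W(x,t,z)$, $x\ge 0$, where $G=izj+V$. Then in the half-plane $\Im z<-M$ the evolution of the Weyl function is given by $$\varphi(t,z)=\big(R_{11}(t,z)\varphi(0,z)+R_{12}(t,z)\big)\big(R_{21}(t,z)\varphi(0,z)+R_{22}(t,z)\big)^{-1},$$ where the block matrix function $R(t,z)=\{R_{kn}(t,z)\}_{k,n=1}^2$ (with $p\times p$ blocks) is determined by the boundary values $v(0,t)$, $v_x(0,t)$, $v_{xx}(0,t)$ through $$\frac{d}{dt}R(t,z)=F(0,t,z)R(t,z),\qquad R(0,z)=I_{2p}.$$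
   Context: Here $m=2p$, $a>0$, $C^1(\mathcal{D})$ denotes continuously differentiable matrix functions on $\mathcal{D}$, subscripts denote partial derivatives, $I_k$ is the $k\times k$ identity matrix, and $$j=\begin{pmatrix} I_p&0\\0&-I_p\end{pmatrix},\qquad V(x,t)=\begin{pmatrix}0&v(x,t)\\-v(x,t)^*&0\end{pmatrix},\qquad G(x,t,z)=izj+V(x,t),$$ $$F(x,t,z)=-iz^3j-z^2V-\frac{iz}{2}\big(V^2j+V_xj\big)+\frac14\big(V_{xx}-2V^3-V_xV+VV_x\big).$$ Weyl function: for a system $\frac{d}{dx}w(x,z)=(izj+V(x))w(x,z)$, $x\ge 0$, where $V=\begin{pmatrix}0&v\\-v^*&0\end{pmatrix}$ and $v$ is a measurable $p\times p$ matrix function with $\sup_{0<x<\infty}\|v(x)\|\le M$, let $W(x,z)$ be the fundamental solution normalized by $W(0,z)=I_{2p}$. The Weyl function of the system is the $p\times p$ matrix function $\varphi(z)$ which is uniquely defined in the half-plane $\Im z<-M$ by $$\int_0^\infty \begin{pmatrix}\varphi(z)^*&I_p\end{pmatrix}W(x,z)^*W(x,z)\begin{pmatrix}\varphi(z)\\ I_p\end{pmatrix}dx<\infty ,\qquad \Im z<-M<0 .$$ (It is a known fact that such a Weyl function exists, is unique, and is holomorphic in $\Im z<-M$.) For each fixed $t$ this definition is applied with $v(x)=v(x,t)$, giving $\varphi(t,z)$. *)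

(* Defs.v *)
From HB Require Import structures.
From mathcomp Require Import all_boot all_order all_algebra.
From mathcomp Require Import complex.
From mathcomp Require Import all_classical all_reals all_analysis.

Set Implicit Arguments.
Unset Strict Implicit.
Unset Printing Implicit Defensive.

Import Order.TTheory GRing.Theory Num.Theory.
Import numFieldNormedType.Exports.

Local Open Scope classical_set_scope.
Local Open Scope ring_scope.
Local Open Scope complex_scope.
Local Open Scope sesquilinear_scope.

(* The library puts no topology on R[i] as a normed space over R: limits,
   derivatives and integrals of complex matrix functions are taken entrywise,
   on real and imaginary parts. *)
Section ComplexMatrixFunctions.
Variable R : realType.
Local Notation C := R[i].

(* The derivative of f at x relative to S: one-sided at a boundary point of
   an interval S, and independent of the values of f outside S. *)
Definition deriv_within (S : set R) (f : R -> R) (x l : R) : Prop :=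
  (f y - f x) / (y - x) @[y --> within S x^'] --> l.

Definition mx_deriv_within (m n : nat) (S : set R) (f : R -> 'M[C]_(m, n))
    (x : R) (L : 'M[C]_(m, n)) : Prop :=
  forall i j,
    deriv_within S (fun y => complex.Re (f y i j)) x (complex.Re (L i j)) /\
    deriv_within S (fun y => complex.Im (f y i j)) x (complex.Im (L i j)).

Definition mx_continuous_within (m n : nat) (D : set (R * R))
    (f : R -> R -> 'M[C]_(m, n)) : Prop :=
  forall i j,
    {within D, continuous (fun q : R * R => complex.Re (f q.1 q.2 i j) : R)} /\
    {within D, continuous (fun q : R * R => complex.Im (f q.1 q.2 i j) : R)}.

Definition mx_integrable (m n : nat) (S : set R)
    (f : R -> 'M[C]_(m, n)) : Prop :=
  forall i j,
    lebesgue_measure.-integrable S (EFin \o (fun x => complex.Re (f x i j))) /\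
    lebesgue_measure.-integrable S (EFin \o (fun x => complex.Im (f x i j))).

Definition l2norm (n : nat) (u : 'cV[C]_n) : R :=
  Num.sqrt (\sum_(i < n) (complex.Re (u i 0) ^+ 2 + complex.Im (u i 0) ^+ 2)).

(* The spectral norm of a matrix; the library's norm on matrices is the
   maximum of the moduli of the entries. *)
Definition opnorm (m n : nat) (A : 'M[C]_(m, n)) : R :=
  sup [set l2norm (A *m u) | u in [set u : 'cV[C]_n | l2norm u <= 1]].

End ComplexMatrixFunctions.

Section DiracSystem.
Variables (R : realType) (p : nat).
Local Notation C := R[i].

Definition jmx : 'M[C]_(p + p) := block_mx 1%:M 0 0 (- 1%:M).

Definition potential (v : 'M[C]_p) : 'M[C]_(p + p) :=
  block_mx 0 v (- v^t*) 0.

Definition Gmx (v : 'M[C]_p) (z : C) : 'M[C]_(p + p) :=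
  ('i%C * z) *: jmx + potential v.

(* v, vx and vxx are the values of v and of its first two x-derivatives;
   potential is real-linear, so it sends them to V, V_x and V_xx. *)
Definition Fmx (v vx vxx : 'M[C]_p) (z : C) : 'M[C]_(p + p) :=
  let V := potential v in
  let Vx := potential vx in
  let Vxx := potential vxx in
  - ('i%C * z ^+ 3) *: jmx - z ^+ 2 *: V
  - ('i%C * z / 2) *: (V *m V *m jmx + Vx *m jmx)
  + 4^-1 *: (Vxx - 2 *: (V *m V *m V) - Vx *m V + V *m Vx).

Definition is_fundamental_solution (v : R -> 'M[C]_p) (z : C)
    (W : R -> 'M[C]_(p + p)) : Prop :=
  W 0 = 1%:M /\
  forall x, 0 <= x -> mx_deriv_within `[0, +oo[ W x (Gmx (v x) z *m W x).

Definition is_weyl_function (M : R) (v : R -> 'M[C]_p)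
    (phi : C -> 'M[C]_p) : Prop :=
  forall z : C, complex.Im z < - M ->
    exists2 W : R -> 'M[C]_(p + p), is_fundamental_solution v z W &
      mx_integrable `[0, +oo[ (fun x =>
        row_mx ((phi z)^t*) 1%:M *m (W x)^t* *m W x *m col_mx (phi z) 1%:M).

End DiracSystem.

(* Main.v *)
Require Import Defs.
From HB Require Import structures.
From mathcomp Require Import all_boot all_order all_algebra.
From mathcomp Require Import complex.
From mathcomp Require Import all_classical all_reals all_analysis.
From mathcomp Require Import ring lra.

Set Implicit Arguments.
Unset Strict Implicit.
Unset Printing Implicit Defensive.

Import Order.TTheory GRing.Theory Num.Theory.
Import numFieldNormedType.Exports.

Local Open Scope classical_set_scope.
Local Open Scope ring_scope.
Local Open Scope complex_scope.
Local Open Scope sesquilinear_scope.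

(** Let H(t) = col (phi(t, z), 1), let W(x, t) be the fundamental solution of the
    Dirac system at time t, and put Y(x, t) = W(x, t) R(t) H(0). Then Y_x = G Y,
    and Y_t = F Y at x = 0. In terms of potentials the mKdV
    equation is the zero curvature equation F_x = G_t + G F - F G
    (zero_curvature), which is the compatibility condition of the two systems,
    so Y_t = F Y holds for every x (Y_time_derivative).

    The smoothness of Y in t comes out of the same argument. For fixed t and
    small k the remainder
    d(x) = Y(x, t + k) - Y(x, t) - k F(x, t) Y(x, t) solves an inhomogeneous
    Dirac system; by the zero curvature equation its right-hand side only
    involves V(x, t + k) - V(x, t) - k V_t(x, t) and k (V(x, t + k) - V(x, t)),
    both o(k) uniformly for x in a compact interval. Since d(0) = o(k),
    Gronwall's inequality gives d(x) = o(k).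

    The matrix F is bounded on the whole domain because v, v_x and v_xx are.
    Gronwall's inequality in t therefore gives |Y(x, t)|^2 <= K |Y(x, 0)|^2 with
    K independent of x (Y_time_growth), and Y(x, 0) = W(x, 0) H(0) is square
    integrable by the definition of phi(0, z). So Y(., t) is a square integrable
    solution that starts at R(t) H(0) = col (A, B), where A and B are the numerator
    and the denominator of the linear fractional transformation.

    On the other hand, for Im z < - M the form |u_1|^2 - |u_2|^2 is nondecreasing
    along solutions of the Dirac system, so that a square integrable solution
    which starts at col (g, 0) has g = 0 (decaying_solution_eq0). If B f = 0,
    applying this to Y f yields A f = 0, hence R(t) H(0) f = 0, hence
    H(0) f = 0 by backward uniqueness for the t-system, hence f = 0: B is
    invertible. Applying it to Y B^-1 - W H(t), which starts at
    col (A B^-1 - phi(t, z), 0), yields phi(t, z) = A B^-1.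

    Norms are squared Frobenius norms (sq) throughout; bounds on the
    spectral norm are converted by opnorm_sqM_le. *)

(** * Derivatives relative to a set *)

Section RealDerivative.
Variable R : realType.
Implicit Types (S : set R) (f g : R -> R) (x l m : R).

(** The quotient-free form of the definition: the point y = x needs no
    exclusion here, and error terms of this shape can be added up. It is the
    form in which derivatives are produced and consumed below. *)
Lemma deriv_withinP S f x l : deriv_within S f x l <->
  forall e, 0 < e ->
    \forall y \near x, S y -> `|f y - f x - l * (y - x)| <= e * `|y - x|.
Proof.
split=> [fl e e0|fl].
  have /cvgrPdist_le /(_ _ e0) := fl.
  rewrite /prop_near1 /= => H.
  have {}H : \forall y \near x, y != x -> S y ->
      `|l - (f y - f x) / (y - x)| <= e by exact: H.
  near=> y => Sy; have [->|yx] := eqVneq y x; first by rewrite !subrr mulr0 subrr normr0 mulr0.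
  have yx0 : y - x != 0 by rewrite subr_eq0.
  rewrite -[f y - f x](divfK yx0) -mulrBl normrM ler_wpM2r// distrC.
  by apply: (near H y).
apply/cvgrPdist_le => e e0.
have H := fl _ e0.
suff : \forall y \near x, y != x -> S y ->
      `|l - (f y - f x) / (y - x)| <= e by [].
near=> y => yx Sy.
have yx0 : y - x != 0 by rewrite subr_eq0.
rewrite -(ler_pM2r (_ : 0 < `|y - x|)) ?normr_gt0// -normrM mulrBl divfK// distrC.
by apply: (near H y).
Unshelve. all: by end_near. Qed.

Lemma deriv_withinS S T f x l :
  S `<=` T -> deriv_within T f x l -> deriv_within S f x l.
Proof.
move=> ST /deriv_withinP H; apply/deriv_withinP => e /H; apply: filterS => y + /ST.
by move=> + Ty => /(_ Ty).
Qed.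

Lemma deriv_within_is_derive S f x l :
  is_derive x 1 f l -> deriv_within S f x l.
Proof.
move=> [df dl]; apply: (deriv_withinS (@subsetT _ S)).
move: df; rewrite /derivable -/('D_1 f x) dl => df.
apply/deriv_withinP => e e0.
have /cvgrPdist_le /(_ _ e0) H := df.
have {}H : \forall h \near 0, h != 0 -> `|l - h^-1 *: (f (h *: 1 + x) - f x)| <= e.
  exact: H.
have {}H : \forall y \near x, y - x != 0 ->
    `|l - (y - x)^-1 *: (f ((y - x) *: 1 + x) - f x)| <= e.
  have : y - x @[y --> x] --> 0.
    by rewrite -(subrr x); apply: cvgB; [exact: cvg_id|exact: cvg_cst].
  by move=> /(_ _ H).
near=> y => _; have [->|yx] := eqVneq y x.
  by rewrite !subrr mulr0 subrr normr0 mulr0.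
have yx0 : y - x != 0 by rewrite subr_eq0.
have := near H y _ yx0; rewrite [_ *: 1]mulr1 subrK => /(_ _) Hy.
rewrite -[f y - f x](divfK yx0) -mulrBl normrM ler_wpM2r// distrC mulrC.
exact: Hy.
Unshelve. all: by end_near. Qed.

Lemma is_derive_deriv_within S f x l :
  nbhs x S -> deriv_within S f x l -> is_derive x 1 f l.
Proof.
move=> xS /deriv_withinP fl.
suff H : h^-1 *: ((f \o shift x) (h *: 1) - f x) @[h --> 0^'] --> l.
  split; first by apply/cvg_ex; exists l.
  exact: cvg_lim H.
apply/cvgrPdist_le => e e0.
suff : \forall h \near 0, h != 0 -> `|l - h^-1 *: (f (h *: 1 + x) - f x)| <= e.
  by [].
have : \forall h \near 0, S (h + x) /\
    `|f (h + x) - f x - l * (h + x - x)| <= e * `|h + x - x|.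
  have : h + x @[h --> 0] --> x.
    by rewrite -[X in _ --> X]add0r; apply: cvgD; [exact: cvg_id|exact: cvg_cst].
  suff Q : \forall y \near x, S y /\ `|f y - f x - l * (y - x)| <= e * `|y - x|.
    by move=> /(_ _ Q).
  near=> y; have Sy : S y by near: y.
  by split=> //; exact: (near (fl _ e0) y).
apply: filterS => h [_]; rewrite addrK [_ *: 1]mulr1 => H h0.
rewrite -(ler_pM2r (_ : 0 < `|h|)) ?normr_gt0// -normrM mulrBl.
by rewrite [_ *: _]mulrC divfK// distrC.
Unshelve. all: by end_near. Qed.

Lemma deriv_within_cvg S f x l :
  deriv_within S f x l -> f y @[y --> within S (nbhs x)] --> f x.
Proof.
move=> /deriv_withinP /(_ _ ltr01) H.
apply/cvgrPdist_le => e e0.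
suff : \forall y \near x, S y -> `|f x - f y| <= e by [].
have : (1 + `|l|) * (y - x) @[y --> x] --> 0.
  rewrite -(mulr0 (1 + `|l|)) -(subrr x); apply: cvgM; first exact: cvg_cst.
  by apply: cvgB; [exact: cvg_id|exact: cvg_cst].
move=> /cvgrPdist_le /(_ _ e0) H2.
(* The increment of f is at most (1 + |l|) |y - x|, by the characterization
   of the derivative with error constant 1. *)
have {}H2 : \forall y \near x, (1 + `|l|) * `|y - x| <= e.
  apply: filterS H2 => y.
  by rewrite sub0r normrN normrM [`|1 + _|]ger0_norm ?addr_ge0.
near=> y => Sy.
have H2y : (1 + `|l|) * `|y - x| <= e by near: y.
rewrite distrC; apply: le_trans H2y.
rewrite -(subrK (l * (y - x)) (f y - f x)) (le_trans (ler_normD _ _))//.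
by rewrite mulrDl normrM lerD// mul1r -[X in _ <= X]mul1r; apply: (near H y).
Unshelve. all: by end_near. Qed.

Lemma deriv_within_cst S c x : deriv_within S (fun=> c) x 0.
Proof.
by apply/deriv_withinP => e e0; near=> y => _; rewrite subrr mul0r subr0 normr0 mulr_ge0// ltW.
Unshelve. all: by end_near. Qed.

Lemma deriv_withinD S f g x l m :
  deriv_within S f x l -> deriv_within S g x m ->
  deriv_within S (fun y => f y + g y) x (l + m).
Proof.
move=> fl gm; rewrite /deriv_within.
rewrite (_ : (fun _ => _) =
  (fun y => (f y - f x) / (y - x) + (g y - g x) / (y - x))); first exact: cvgD.
by apply/funext => y; rewrite -mulrDl; congr (_ / _); ring.
Qed.

Lemma deriv_withinM S f g x l m :
  deriv_within S f x l -> deriv_within S g x m ->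
  deriv_within S (fun y => f y * g y) x (l * g x + f x * m).
Proof.
move=> fl gm; rewrite /deriv_within.
rewrite (_ : (fun _ => _) =
  (fun y => (f y - f x) / (y - x) * g y + f x * ((g y - g x) / (y - x)))).
  apply: cvgD; first apply: cvgM => //.
    have := deriv_within_cvg gm; apply: cvg_trans; apply: cvg_app => P.
    suff : (\forall y \near x, S y -> P y) -> \forall y \near x, y != x -> S y -> P y by [].
    by apply: filterS => y H _ /H.
  by apply: cvgM => //; apply: cvg_cst.
by apply/funext => y; ring.
Qed.

Lemma deriv_withinN S f x l :
  deriv_within S f x l -> deriv_within S (fun y => - f y) x (- l).
Proof.
move=> fl.
have := deriv_withinM (deriv_within_cst S (-1) x) fl.
rewrite mul0r add0r mulN1r (_ : (fun _ => _) = (fun y => - f y))//.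
by apply/funext => y; rewrite mulN1r.
Qed.

Lemma deriv_within_sum (I : Type) (r : seq I) S (F : I -> R -> R) x (L : I -> R) :
  (forall i, deriv_within S (F i) x (L i)) ->
  deriv_within S (fun y => \sum_(i <- r) F i y) x (\sum_(i <- r) L i).
Proof.
move=> H; elim: r => [|i r IH].
  rewrite big_nil (_ : (fun _ => _) = fun=> 0); first exact: deriv_within_cst.
  by apply/funext => y; rewrite big_nil.
rewrite big_cons (_ : (fun _ => _) = fun y => F i y + \sum_(i <- r) F i y).
  exact: deriv_withinD.
by apply/funext => y; rewrite big_cons.
Qed.

(** The mean value theorem: at interior points the relative derivative is
    the ordinary one, and at the end points only continuity is needed. *)
Lemma deriv_within_ge0 (a b : R) f (f' : R -> R) : a <= b ->
  (forall x, x \in `[a, b] -> deriv_within `[a, b] f x (f' x)) ->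
  (forall x, x \in `[a, b] -> 0 <= f' x) -> f a <= f b.
Proof.
move=> ab df f'0.
have [x|x|c cab fab] := MVT_segment (f := f) (df := f') ab.
- move=> xab; apply: (is_derive_deriv_within (S := `[a, b])).
    by have := near_in_itvoo xab; apply: filterS => y; exact: subset_itv_oo_cc.
  by apply: df; exact: subset_itv_oo_cc.
- by move: x; apply/subspace_continuousP => x xab; exact: deriv_within_cvg (df _ xab).
- by rewrite -subr_ge0 fab mulr_ge0 ?subr_ge0// f'0.
Qed.

End RealDerivative.

(** * Differential inequalities *)

Section Gronwall.
Variables (R : realType) (a b : R).
Hypothesis ab : a <= b.

Lemma deriv_within_expR S (k x : R) :
  deriv_within S (fun y => expR (k * (y - a))) x (k * expR (k * (x - a))).
Proof.
apply: deriv_within_is_derive.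
have H : is_derive x 1 (fun y : R => k * (y - a)) k.
  apply: (is_derive_deriv_within (S := setT)); first exact: filterT.
  apply/deriv_withinP => e e0; apply: filterE => y _.
  rewrite (_ : _ - _ = 0); last by ring.
  by rewrite normr0 mulr_ge0// ltW.
rewrite mulrC.
exact: (@is_derive1_comp _ expR (fun y => k * (y - a)) x _ _ (is_derive_expR _) H).
Qed.

(** Monotonicity of e (x - a) - exp (- L (x - a)) f(x): its derivative is
    e - exp (- L (x - a)) (f' - L f), which is nonnegative because the
    exponential is at most 1. *)
Lemma gronwall (f f' : R -> R) (L e : R) : 0 <= L -> 0 <= e ->
  (forall x, x \in `[a, b] -> deriv_within `[a, b] f x (f' x)) ->
  (forall x, x \in `[a, b] -> f' x <= L * f x + e) ->
  f b <= expR (L * (b - a)) * (f a + e * (b - a)).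
Proof.
move=> L0 e0 df f'le.
have := @deriv_within_ge0 _ a b
  (fun x => expR (- L * (x - a)) * - f x + e * (x - a)) (fun x =>
  (- L * expR (- L * (x - a)) * - f x + expR (- L * (x - a)) * - f' x)
  + (0 * (x - a) + e * (1 - 0))) ab.
rewrite subrr !mulr0 expR0 mul1r addr0 => H.
have {H} : - f a <= expR (- L * (b - a)) * - f b + e * (b - a).
  apply: H => x xab.
    apply: deriv_withinD; [apply: deriv_withinM|].
    - exact: deriv_within_expR.
    - by apply: deriv_withinN; exact: df.
    - apply: deriv_withinM; first exact: deriv_within_cst.
      apply: deriv_withinD; last by apply: deriv_withinN; exact: deriv_within_cst.
      by apply: deriv_within_is_derive; exact: is_derive_id.
  rewrite mul0r add0r subr0 mulr1.
  set E := expR _; have E0 : 0 < E by exact: expR_gt0.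
  have E1 : E <= 1.
    by rewrite -expR0 ler_expR mulNr oppr_le0 mulr_ge0// subr_ge0; case/andP: xab.
  have /(ler_wpM2l (ltW E0)) := f'le x xab.
  rewrite mulrDr; have : E * e <= e by rewrite ler_piMl.
  by lra.
rewrite mulNr expRN; set E := expR _ => H.
have E0 : 0 < E by exact: expR_gt0.
have := ler_wpM2l (ltW E0) H; rewrite mulrDr mulVKf ?gt_eqF//; lra.
Qed.

(** Monotonicity of exp (L (x - a)) f(x). This direction shows that a
    solution of a linear system that vanishes at some time vanished before,
    and so replaces the inversion of a fundamental matrix. *)
Lemma gronwall_backward (f f' : R -> R) (L : R) :
  (forall x, x \in `[a, b] -> deriv_within `[a, b] f x (f' x)) ->
  (forall x, x \in `[a, b] -> - (L * f x) <= f' x) ->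
  f a <= expR (L * (b - a)) * f b.
Proof.
move=> df f'ge.
have := @deriv_within_ge0 _ a b (fun x => expR (L * (x - a)) * f x) (fun x =>
  L * expR (L * (x - a)) * f x + expR (L * (x - a)) * f' x) ab.
rewrite subrr mulr0 expR0 mul1r; apply => x xab.
  by apply: deriv_withinM; [exact: deriv_within_expR|exact: df].
have /(ler_wpM2l (ltW (expR_gt0 (L * (x - a))))) := f'ge x xab.
lra.
Qed.

End Gronwall.

(** * The Frobenius inner product and the spectral norm *)

Section FrobeniusProduct.
Variable R : realType.
Local Notation C := R[i].

Lemma cReD (x y : C) : complex.Re (x + y) = complex.Re x + complex.Re y.
Proof. by case: x y => [a b] [c d]. Qed.

Lemma cImD (x y : C) : complex.Im (x + y) = complex.Im x + complex.Im y.
Proof. by case: x y => [a b] [c d]. Qed.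

Lemma cReN (x : C) : complex.Re (- x) = - complex.Re x.
Proof. by case: x. Qed.

Lemma cImN (x : C) : complex.Im (- x) = - complex.Im x.
Proof. by case: x. Qed.

Lemma cReM (x y : C) : complex.Re (x * y) =
  complex.Re x * complex.Re y - complex.Im x * complex.Im y.
Proof. by case: x y => [a b] [c d]. Qed.

Lemma cImM (x y : C) : complex.Im (x * y) =
  complex.Re x * complex.Im y + complex.Im x * complex.Re y.
Proof. by case: x y => [a b] [c d]; rewrite /= addrC. Qed.

Lemma cRe_conj (x : C) : complex.Re (Num.conj x) = complex.Re x.
Proof. by case: x. Qed.

Lemma cIm_conj (x : C) : complex.Im (Num.conj x) = - complex.Im x.
Proof. by case: x. Qed.

Lemma cRe_sum I (r : seq I) P (F : I -> C) :
  complex.Re (\sum_(i <- r | P i) F i) = \sum_(i <- r | P i) complex.Re (F i).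
Proof. by elim/big_rec2: _ => // i x y _ <-; rewrite cReD. Qed.

Lemma cIm_sum I (r : seq I) P (F : I -> C) :
  complex.Im (\sum_(i <- r | P i) F i) = \sum_(i <- r | P i) complex.Im (F i).
Proof. by elim/big_rec2: _ => // i x y _ <-; rewrite cImD. Qed.

(** The squared modulus with values in R: the norm of R[i] takes its values
    in R[i], where real inequalities are awkward to handle. *)
Definition modsq (x : C) : R := complex.Re x ^+ 2 + complex.Im x ^+ 2.

Lemma modsq_ge0 x : 0 <= modsq x.
Proof. by rewrite addr_ge0 ?sqr_ge0. Qed.

Lemma modsqM x y : modsq (x * y) = modsq x * modsq y.
Proof. by rewrite /modsq cReM cImM; ring. Qed.

Lemma modsq_eq0 x : modsq x = 0 -> x = 0.
Proof.
move=> /eqP; rewrite paddr_eq0 ?sqr_ge0// !sqrf_eq0 => /andP[/eqP r0 /eqP i0].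
by case: x r0 i0 => a b /= -> ->.
Qed.

(** Cauchy-Schwarz, from the Lagrange identity: twice the difference of the
    two sides is a double sum over k and l, in which each summand is the
    squared modulus of a_k conj(b_l) - a_l conj(b_k). *)
Lemma modsq_sumM_le n (a b : 'I_n -> C) : modsq (\sum_k a k * b k) <=
  (\sum_k modsq (a k)) * (\sum_k modsq (b k)).
Proof.
have dbl (F G : 'I_n -> R) : (\sum_k F k) * (\sum_k G k) = \sum_k \sum_l F k * G l.
  by rewrite mulr_suml; apply: eq_bigr => k _; rewrite mulr_sumr.
rewrite -(ler_pM2l (_ : 0 < 2))// {1}/modsq cRe_sum cIm_sum !expr2 !dbl.
rewrite -big_split mulr_sumr /=.
under eq_bigr do rewrite -big_split mulr_sumr /=.
rewrite [leRHS]mulr_natl mulr2n [X in _ <= _ + X]exchange_big -big_split/= ler_sum// => k _.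
rewrite -big_split ler_sum//= => l _.
rewrite !cReM !cImM /modsq.
case: (a k) (b k) (a l) (b l) => [a1 a2] [b1 b2] [c1 c2] [d1 d2] /=.
rewrite -subr_ge0.
set X := (X in 0 <= X).
have -> : X = (a1 * d1 + a2 * d2 - (b1 * c1 + b2 * c2)) ^+ 2 +
              (a2 * d1 - a1 * d2 + (b2 * c1 - b1 * c2)) ^+ 2 by rewrite /X; ring.
by rewrite addr_ge0 ?sqr_ge0.
Qed.

(** The real part of the Frobenius product. The trace form makes the
    adjunction dot_adj immediate; dotE gives the entrywise form. *)
Definition dot m n (A B : 'M[C]_(m, n)) : R := complex.Re (\tr (A^t* *m B)).

Definition sq m n (A : 'M[C]_(m, n)) : R := dot A A.

Lemma dotE m n (A B : 'M[C]_(m, n)) : dot A B = \sum_j \sum_i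
  (complex.Re (A i j) * complex.Re (B i j) + complex.Im (A i j) * complex.Im (B i j)).
Proof.
rewrite /dot /mxtrace cRe_sum; apply: eq_bigr => j _.
rewrite mxE cRe_sum; apply: eq_bigr => i _.
by rewrite !mxE cReM cRe_conj cIm_conj mulNr opprK.
Qed.

Lemma dotC m n (A B : 'M[C]_(m, n)) : dot A B = dot B A.
Proof.
by rewrite !dotE; apply: eq_bigr => j _; apply: eq_bigr => i _; ring.
Qed.

Lemma dotDr m n (A B D : 'M[C]_(m, n)) : dot A (B + D) = dot A B + dot A D.
Proof. by rewrite /dot mulmxDr mxtraceD cReD. Qed.

Lemma dotNr m n (A B : 'M[C]_(m, n)) : dot A (- B) = - dot A B.
Proof. by rewrite /dot mulmxN raddfN cReN. Qed.

Lemma dotDl m n (A B D : 'M[C]_(m, n)) : dot (A + B) D = dot A D + dot B D.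
Proof. by rewrite dotC dotDr !(dotC D). Qed.

Lemma dotNl m n (A B : 'M[C]_(m, n)) : dot (- A) B = - dot A B.
Proof. by rewrite dotC dotNr dotC. Qed.

Lemma dot_adj m n q (V : 'M[C]_(m, n)) (A : 'M[C]_(n, q)) (B : 'M[C]_(m, q)) :
  dot A (V^t* *m B) = dot (V *m A) B.
Proof. by rewrite /dot trmx_mul map_mxM mulmxA. Qed.

Lemma sqE m n (A : 'M[C]_(m, n)) : sq A = \sum_j \sum_i modsq (A i j).
Proof.
by rewrite /sq dotE; apply: eq_bigr => j _; apply: eq_bigr => i _; rewrite -!expr2.
Qed.

Lemma sq_ge0 m n (A : 'M[C]_(m, n)) : 0 <= sq A.
Proof. by rewrite sqE sumr_ge0// => j _; rewrite sumr_ge0// => i _; exact: modsq_ge0. Qed.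

Lemma sq0 m n : sq (0 : 'M[C]_(m, n)) = 0.
Proof. by rewrite /sq /dot mulmx0 raddf0. Qed.

Lemma modsq_le_sq m n (A : 'M[C]_(m, n)) i j : modsq (A i j) <= sq A.
Proof.
rewrite sqE (bigD1 j)//= (bigD1 i)//= -addrA lerDl.
rewrite addr_ge0 ?sumr_ge0// => *; first exact: modsq_ge0.
by rewrite sumr_ge0// => *; exact: modsq_ge0.
Qed.

Lemma sq_eq0 m n (A : 'M[C]_(m, n)) : sq A <= 0 -> A = 0.
Proof.
move=> A0; apply/matrixP => i j; rewrite mxE; apply: modsq_eq0.
by apply/eqP; rewrite eq_le modsq_ge0 andbT (le_trans (modsq_le_sq _ _ _)).
Qed.

Lemma dot_le_sq m n (A B : 'M[C]_(m, n)) : 2 * dot A B <= sq A + sq B.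
Proof.
have := sq_ge0 (A - B); rewrite /sq dotDr !dotDl !dotNr !dotNl (dotC B A); lra.
Qed.

Lemma dot_ge_sq m n (A B : 'M[C]_(m, n)) : - (sq A + sq B) <= 2 * dot A B.
Proof. by have := dot_le_sq A (- B); rewrite /sq !dotNr dotNl; lra. Qed.

Lemma sqD_le m n (A B : 'M[C]_(m, n)) : sq (A + B) <= 2 * sq A + 2 * sq B.
Proof.
by have := dot_le_sq A B; rewrite /sq dotDr !dotDl (dotC B A); lra.
Qed.

Lemma sqN m n (A : 'M[C]_(m, n)) : sq (- A) = sq A.
Proof. by rewrite /sq dotNr dotNl opprK. Qed.

Lemma sqZ m n (c : C) (A : 'M[C]_(m, n)) : sq (c *: A) = modsq c * sq A.
Proof.
rewrite !sqE mulr_sumr; apply: eq_bigr => j _.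
by rewrite mulr_sumr; apply: eq_bigr => i _; rewrite mxE modsqM.
Qed.

Lemma sqM_le m n q (A : 'M[C]_(m, n)) (B : 'M[C]_(n, q)) :
  sq (A *m B) <= sq A * sq B.
Proof.
have -> : sq A * sq B =
    \sum_j \sum_i (\sum_k modsq (A i k)) * (\sum_k modsq (B k j)).
  rewrite !sqE exchange_big /= mulr_sumr; apply: eq_bigr => j _.
  by rewrite mulr_suml.
rewrite sqE ler_sum// => j _; rewrite ler_sum// => i _.
by rewrite mxE; exact: modsq_sumM_le.
Qed.

Lemma sq_ctr m n (A : 'M[C]_(m, n)) : sq (A^t*) = sq A.
Proof.
rewrite !sqE exchange_big; apply: eq_bigr => i _; apply: eq_bigr => j _.
by rewrite !mxE /modsq cRe_conj cIm_conj sqrrN.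
Qed.

Lemma sq_col_mx m1 m2 n (A : 'M[C]_(m1, n)) (B : 'M[C]_(m2, n)) :
  sq (col_mx A B) = sq A + sq B.
Proof.
rewrite !sqE -big_split/=; apply: eq_bigr => j _; rewrite big_split_ord/=.
by congr (_ + _); apply: eq_bigr => i _; rewrite ?col_mxEu ?col_mxEd.
Qed.

Lemma sq_block_mx m1 m2 n1 n2 (A : 'M[C]_(m1, n1)) (B : 'M[C]_(m1, n2))
    (D : 'M[C]_(m2, n1)) (E : 'M[C]_(m2, n2)) :
  sq (block_mx A B D E) = sq A + sq D + (sq B + sq E).
Proof.
rewrite !sqE big_split_ord /= -!big_split/=; congr (_ + _); apply: eq_bigr => j _;
  rewrite big_split_ord/=; congr (_ + _); apply: eq_bigr => i _.
- by rewrite block_mxEul.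
- by rewrite block_mxEdl.
- by rewrite block_mxEur.
- by rewrite block_mxEdr.
Qed.

Lemma sq_cols m n (A : 'M[C]_(m, n)) : sq A = \sum_j sq (col j A).
Proof.
rewrite sqE; apply: eq_bigr => j _; rewrite sqE big_ord1.
by apply: eq_bigr => i _; rewrite mxE.
Qed.

Lemma l2normE n (u : 'cV[C]_n) : l2norm u = Num.sqrt (sq u).
Proof. by rewrite /l2norm sqE big_ord1. Qed.

(** The supremum that defines the spectral norm is taken over a set that
    the Frobenius norm bounds. *)
Lemma opnorm_ub m n (A : 'M[C]_(m, n)) (u : 'cV[C]_n) :
  l2norm u <= 1 -> l2norm (A *m u) <= opnorm A.
Proof.
move=> u1; apply: ub_le_sup; last by exists u.
exists (Num.sqrt (sq A)) => _ [w /= w1 <-].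
rewrite l2normE ler_wsqrtr//; apply: le_trans (sqM_le _ _) _.
rewrite ler_piMr ?sq_ge0//.
by move: w1; rewrite l2normE -[X in _ <= X -> _]sqrtr1 ler_sqrt.
Qed.

Lemma opnorm_ge0 m n (A : 'M[C]_(m, n)) : 0 <= opnorm A.
Proof.
apply: le_trans (opnorm_ub (u := 0) A _); first by rewrite l2normE sqrtr_ge0.
by rewrite l2normE sq0 sqrtr0.
Qed.

(** Column by column, by homogeneity. The constant is sharp, which matters:
    the Weyl half-plane is cut out by the bound M on the spectral norm. *)
Lemma opnorm_sqM_le m n q (A : 'M[C]_(m, n)) (B : 'M[C]_(n, q)) (K : R) :
  opnorm A <= K -> sq (A *m B) <= K ^+ 2 * sq B.
Proof.
move=> AK; rewrite (sq_cols (A *m B)) (sq_cols B) mulr_sumr ler_sum// => j _.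
rewrite colE -mulmxA -colE; move: (col j B) => {j q B} u.
have [u0|u0] := leP (sq u) 0.
  by rewrite (sq_eq0 u0) mulmx0 !sq0 mulr0.
pose r := Num.sqrt (sq u); have r0 : 0 < r by rewrite sqrtr_gt0.
have rr : r ^+ 2 = sq u by rewrite sqr_sqrtr// ltW.
have mr : modsq (r^-1)%:C = (r ^+ 2)^-1 by rewrite /modsq /= expr0n addr0 exprVn.
have := @opnorm_ub _ _ A ((r^-1)%:C *: u).
rewrite !l2normE -scalemxAr !sqZ mr rr mulVf ?gt_eqF// sqrtr1 lexx => /(_ isT) H.
have {H} := le_trans H AK; set X := Num.sqrt _ => XK.
have : X ^+ 2 <= K ^+ 2 by rewrite lerXn2r// ?nnegrE ?sqrtr_ge0// (le_trans _ XK)// sqrtr_ge0.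
rewrite sqr_sqrtr; last by rewrite mulr_ge0 ?sq_ge0// invr_ge0 ltW.
by rewrite mulrC ler_pdivrMr.
Qed.

(** Where the value of the constant is irrelevant, the Frobenius norm can
    replace the spectral norm. *)
Lemma opnorm_sq_le m n (A : 'M[C]_(m, n)) (K : R) :
  opnorm A <= K -> sq A <= K ^+ 2 * sq (1%:M : 'M[C]_n).
Proof. by move=> /(opnorm_sqM_le 1%:M); rewrite mulmx1. Qed.

End FrobeniusProduct.

(** * Derivatives of complex matrix functions *)

Section MatrixDerivative.
Variable R : realType.
Local Notation C := R[i].
Implicit Types (S : set R) (x : R).

Lemma mx_deriv_withinS m n S T (f : R -> 'M[C]_(m, n)) x L :
  S `<=` T -> mx_deriv_within T f x L -> mx_deriv_within S f x L.
Proof. by move=> ST H i j; have [? ?] := H i j; split; apply: deriv_withinS ST _. Qed.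

Lemma mx_deriv_within_cst m n S (A : 'M[C]_(m, n)) x :
  mx_deriv_within S (fun=> A) x 0.
Proof. by move=> i j; rewrite mxE; split; exact: deriv_within_cst. Qed.

Lemma mx_deriv_withinD m n S (f g : R -> 'M[C]_(m, n)) x L K :
  mx_deriv_within S f x L -> mx_deriv_within S g x K ->
  mx_deriv_within S (fun y => f y + g y) x (L + K).
Proof.
move=> fL gK i j; have [? ?] := fL i j; have [? ?] := gK i j.
rewrite !mxE cReD cImD; split.
  rewrite (_ : (fun _ => _) = fun y => complex.Re (f y i j) + complex.Re (g y i j)).
    exact: deriv_withinD.
  by apply/funext => y; rewrite mxE cReD.
rewrite (_ : (fun _ => _) = fun y => complex.Im (f y i j) + complex.Im (g y i j)).
  exact: deriv_withinD.
by apply/funext => y; rewrite mxE cImD.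
Qed.

Lemma mx_deriv_withinM m n q S (f : R -> 'M[C]_(m, n)) (g : R -> 'M[C]_(n, q))
    x L K :
  mx_deriv_within S f x L -> mx_deriv_within S g x K ->
  mx_deriv_within S (fun y => f y *m g y) x (L *m g x + f x *m K).
Proof.
move=> fL gK i j; rewrite !mxE -big_split/= cRe_sum cIm_sum; split.
  rewrite (_ : (fun _ => _) = fun y => \sum_k
    (complex.Re (f y i k) * complex.Re (g y k j) +
     - (complex.Im (f y i k) * complex.Im (g y k j)))); last first.
    by apply/funext => y; rewrite mxE cRe_sum; apply: eq_bigr => k _; rewrite cReM.
  apply: deriv_within_sum => k; have [? ?] := fL i k; have [? ?] := gK k j.
  rewrite (_ : complex.Re _ =
    (complex.Re (L i k) * complex.Re (g x k j) + complex.Re (f x i k) * complex.Re (K k j)) -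
    (complex.Im (L i k) * complex.Im (g x k j) + complex.Im (f x i k) * complex.Im (K k j)));
    last by rewrite cReD !cReM; ring.
  by apply: deriv_withinD; [|apply: deriv_withinN]; exact: deriv_withinM.
rewrite (_ : (fun _ => _) = fun y => \sum_k
  (complex.Re (f y i k) * complex.Im (g y k j) +
   complex.Im (f y i k) * complex.Re (g y k j))); last first.
  by apply/funext => y; rewrite mxE cIm_sum; apply: eq_bigr => k _; rewrite cImM.
apply: deriv_within_sum => k; have [? ?] := fL i k; have [? ?] := gK k j.
rewrite (_ : complex.Im _ =
  (complex.Re (L i k) * complex.Im (g x k j) + complex.Re (f x i k) * complex.Im (K k j)) +
  (complex.Im (L i k) * complex.Re (g x k j) + complex.Im (f x i k) * complex.Re (K k j)));
  last by rewrite cImD !cImM; ring.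
by apply: deriv_withinD; exact: deriv_withinM.
Qed.

Lemma mx_deriv_withinMr m n q S (f : R -> 'M[C]_(m, n)) (B : 'M[C]_(n, q)) x L :
  mx_deriv_within S f x L -> mx_deriv_within S (fun y => f y *m B) x (L *m B).
Proof.
by move=> /mx_deriv_withinM/(_ (mx_deriv_within_cst S B x)); rewrite mulmx0 addr0.
Qed.

Lemma mx_deriv_withinMl m n q S (f : R -> 'M[C]_(n, q)) (B : 'M[C]_(m, n)) x L :
  mx_deriv_within S f x L -> mx_deriv_within S (fun y => B *m f y) x (B *m L).
Proof.
move=> /(mx_deriv_withinM (mx_deriv_within_cst S B x)).
by rewrite mul0mx add0r.
Qed.

Lemma mx_deriv_withinZ m n S (c : C) (f : R -> 'M[C]_(m, n)) x L :
  mx_deriv_within S f x L -> mx_deriv_within S (fun y => c *: f y) x (c *: L).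
Proof.
move=> /(mx_deriv_withinMl c%:M); rewrite mul_scalar_mx.
by under eq_fun do rewrite mul_scalar_mx.
Qed.

Lemma mx_deriv_withinN m n S (f : R -> 'M[C]_(m, n)) x L :
  mx_deriv_within S f x L -> mx_deriv_within S (fun y => - f y) x (- L).
Proof.
move=> /(mx_deriv_withinZ (-1)); rewrite scaleN1r.
by under eq_fun do rewrite scaleN1r.
Qed.

Lemma mx_deriv_within_ctr m n S (f : R -> 'M[C]_(m, n)) x L :
  mx_deriv_within S f x L -> mx_deriv_within S (fun y => (f y)^t*) x (L^t*).
Proof.
move=> fL i j; have [? fI] := fL j i; rewrite !mxE cRe_conj cIm_conj; split.
  by under eq_fun do rewrite !mxE cRe_conj.
by under eq_fun do rewrite !mxE cIm_conj; exact: deriv_withinN.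
Qed.

Lemma mx_deriv_within_block m1 m2 n1 n2 S (f : R -> 'M[C]_(m1, n1))
    (g : R -> 'M[C]_(m1, n2)) (h : R -> 'M[C]_(m2, n1)) (k : R -> 'M[C]_(m2, n2))
    x f' g' h' k' :
  mx_deriv_within S f x f' -> mx_deriv_within S g x g' ->
  mx_deriv_within S h x h' -> mx_deriv_within S k x k' ->
  mx_deriv_within S (fun y => block_mx (f y) (g y) (h y) (k y)) x
    (block_mx f' g' h' k').
Proof.
move=> df dg dh dk i j.
case: (split_ordP i) => i' ->; case: (split_ordP j) => j' ->.
- rewrite block_mxEul; have [? ?] := df i' j'.
  by split; under eq_fun do rewrite block_mxEul.
- rewrite block_mxEur; have [? ?] := dg i' j'.
  by split; under eq_fun do rewrite block_mxEur.
- rewrite block_mxEdl; have [? ?] := dh i' j'.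
  by split; under eq_fun do rewrite block_mxEdl.
- rewrite block_mxEdr; have [? ?] := dk i' j'.
  by split; under eq_fun do rewrite block_mxEdr.
Qed.

Lemma mx_deriv_within_dsubmx m1 m2 n S (f : R -> 'M[C]_(m1 + m2, n)) x L :
  mx_deriv_within S f x L ->
  mx_deriv_within S (fun y => dsubmx (f y)) x (dsubmx L).
Proof.
move=> fL i j; have [? ?] := fL (rshift _ i) j; rewrite mxE; split;
  by under eq_fun do rewrite mxE.
Qed.

Lemma mx_deriv_within_usubmx m1 m2 n S (f : R -> 'M[C]_(m1 + m2, n)) x L :
  mx_deriv_within S f x L ->
  mx_deriv_within S (fun y => usubmx (f y)) x (usubmx L).
Proof.
move=> fL i j; have [? ?] := fL (lshift _ i) j; rewrite mxE; split;
  by under eq_fun do rewrite mxE.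
Qed.

Lemma deriv_within_sq m n S (f : R -> 'M[C]_(m, n)) x L :
  mx_deriv_within S f x L -> deriv_within S (fun y => sq (f y)) x (2 * dot (f x) L).
Proof.
move=> fL; under eq_fun do rewrite sqE.
rewrite dotE mulr_sumr; apply: deriv_within_sum => j.
rewrite mulr_sumr; apply: deriv_within_sum => i; have [dr di] := fL i j.
rewrite /modsq (_ : _ * _ =
  complex.Re (L i j) * complex.Re (f x i j) + complex.Re (f x i j) * complex.Re (L i j) +
  (complex.Im (L i j) * complex.Im (f x i j) + complex.Im (f x i j) * complex.Im (L i j)));
  last by ring.
exact: (deriv_withinD (deriv_withinM dr dr) (deriv_withinM di di)).
Qed.

Lemma sq_le_entries m n (A : 'M[C]_(m, n)) (d : R) : 0 <= d ->
  (forall i j, `|complex.Re (A i j)| <= d /\ `|complex.Im (A i j)| <= d) ->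
  sq A <= 2 * d ^+ 2 * (m * n)%:R.
Proof.
move=> d0 Ad; rewrite sqE.
apply: (@le_trans _ _ (\sum_(j < n) \sum_(i < m) 2 * d ^+ 2)).
  apply: ler_sum => j _; apply: ler_sum => i _; have [rd id] := Ad i j.
  rewrite /modsq mulr_natl mulr2n lerD//.
    by rewrite -(real_normK (num_real (complex.Re _))) lerXn2r// ?nnegrE.
  by rewrite -(real_normK (num_real (complex.Im _))) lerXn2r// ?nnegrE.
by rewrite sumr_const card_ord sumr_const card_ord -mulrnA mulr_natr.
Qed.

(** How small the entries of an m by n matrix must be for its squared
    Frobenius norm to be below e. *)
Lemma small_entry_bound m n (e : R) : 0 < e ->
  exists2 d : R, 0 < d & 2 * d ^+ 2 * (m * n)%:R <= e.
Proof.
move=> e0; have c0 : 0 < e / (2 * (m * n).+1%:R) by rewrite divr_gt0// mulr_gt0.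
exists (Num.sqrt (e / (2 * (m * n).+1%:R))); first by rewrite sqrtr_gt0.
rewrite sqr_sqrtr ?(ltW c0)//; set k : R := (m * n)%:R; set N : R := (m * n).+1%:R.
have N0 : 0 < N by [].
rewrite (_ : 2 * _ * k = e * (k / N)); last by field; exact: lt0r_neq0.
by rewrite ler_piMr ?(ltW e0)// ler_pdivrMr// mul1r ler_nat.
Qed.

(** The matrix form of deriv_withinP: differentiability is a little-o estimate
    of the squared Frobenius norm of the remainder. *)
Lemma mx_deriv_withinP m n S (f : R -> 'M[C]_(m, n)) x L :
  mx_deriv_within S f x L <->
  forall e, 0 < e -> \forall y \near x, S y ->
    sq (f y - f x - (y - x)%:C *: L) <= e * (y - x) ^+ 2.
Proof.
have ReE y i j : complex.Re ((f y - f x - (y - x)%:C *: L) i j) =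
    complex.Re (f y i j) - complex.Re (f x i j) - complex.Re (L i j) * (y - x).
  by rewrite !mxE !(cReD, cReN, cReM)/=; ring.
have ImE y i j : complex.Im ((f y - f x - (y - x)%:C *: L) i j) =
    complex.Im (f y i j) - complex.Im (f x i j) - complex.Im (L i j) * (y - x).
  by rewrite !mxE !(cImD, cImN, cImM)/=; ring.
split=> [fL e e0|fL i j].
  have [d d0 dle] := small_entry_bound m n e0.
  have H0 (ij : 'I_m * 'I_n) : \forall y \near x, S y ->
      `|complex.Re ((f y - f x - (y - x)%:C *: L) ij.1 ij.2)| <= d * `|y - x| /\
      `|complex.Im ((f y - f x - (y - x)%:C *: L) ij.1 ij.2)| <= d * `|y - x|.
    case: ij => i j /=; have [/deriv_withinP/(_ _ d0) dr
      /deriv_withinP/(_ _ d0) di] := fL i j.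
    near=> y => Sy; rewrite ReE ImE.
    by split; [apply: (near dr y)|apply: (near di y)].
  have H : \forall y \near x, forall ij : 'I_m * 'I_n, S y ->
      `|complex.Re ((f y - f x - (y - x)%:C *: L) ij.1 ij.2)| <= d * `|y - x| /\
      `|complex.Im ((f y - f x - (y - x)%:C *: L) ij.1 ij.2)| <= d * `|y - x|.
    exact: (filter_forall (F := nbhs x) _ H0).
  apply: filterS H => y H Sy.
  apply: (@le_trans _ _ (2 * (d * `|y - x|) ^+ 2 * (m * n)%:R)).
    apply: sq_le_entries; first by rewrite mulr_ge0// ltW.
    by move=> i j; exact: (H (i, j)).
  by rewrite exprMn real_normK ?num_real// mulrA mulrAC ler_wpM2r ?sqr_ge0.
have key (u : R) y e : 0 < e -> u ^+ 2 <= e ^+ 2 * (y - x) ^+ 2 -> `|u| <= e * `|y - x|.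
  move=> e0; rewrite -exprMn => /ler_wsqrtr; rewrite !sqrtr_sqr.
  by rewrite [X in _ <= X]normrM (gtr0_norm e0).
split; apply/deriv_withinP => e e0; have e20 : 0 < e ^+ 2 by rewrite exprn_gt0.
  have := fL _ e20; apply: filterS => y H /H /(le_trans (modsq_le_sq _ i j)).
  rewrite /modsq ReE ImE => {}H; apply: key => //; apply: le_trans H.
  by rewrite lerDl sqr_ge0.
have := fL _ e20; apply: filterS => y H /H /(le_trans (modsq_le_sq _ i j)).
rewrite /modsq ReE ImE => {}H; apply: key => //; apply: le_trans H.
by rewrite lerDr sqr_ge0.
Unshelve. all: by end_near. Qed.

End MatrixDerivative.

(** * The zero curvature equation *)

Section ZeroCurvature.
Variables (R : realType) (p : nat).
Local Notation C := R[i].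

(** The algebra behind the zero curvature equation: J is an involution that
    anticommutes with V, V1, V2, and V, V1, V2, V3 stand for a potential and
    its successive x-derivatives. The terms in front of F G form the
    x-derivative of F, so that the identity reads F_x + F G - G F = V_t once V_t
    is given by the mKdV equation. All powers of c cancel except the zeroth. *)
Lemma commutator_identity (K : numFieldType) n (J V V1 V2 V3 : 'M[K]_n) (c : K) :
  J *m J = 1%:M -> J *m V = - (V *m J) -> J *m V1 = - (V1 *m J) ->
  J *m V2 = - (V2 *m J) ->
  let F := c ^+ 3 *: J + c ^+ 2 *: V - (c / 2) *: (V *m V *m J + V1 *m J)
    + 4^-1 *: (V2 - 2 *: (V *m V *m V) - V1 *m V + V *m V1) in
  let G := c *: J + V in
  c ^+ 2 *: V1 - (c / 2) *: (V1 *m V *m J + V *m V1 *m J + V2 *m J)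
    + 4^-1 *: (V3 - 2 *: (V1 *m V *m V + V *m V1 *m V + V *m V *m V1)
               - V2 *m V + V *m V2)
    + F *m G - G *m F
  = 4^-1 *: (V3 - 3 *: (V1 *m V *m V + V *m V *m V1)).
Proof.
move=> JJ JV JV1 JV2 F G.
have n2 : (2 : K) != 0 by rewrite pnatr_eq0.
have n4 : (4 : K) != 0 by rewrite pnatr_eq0.
have half : 2^-1 = 2 * 4^-1 :> K.
  by apply: (mulIf n2); rewrite mulVf// mulrAC -natrM mulfV.
(* After the denominators are expressed through 4^-1, the coefficient of
   c^2 V1 is the only place where 4^-1 * 4 = 1 is used. *)
rewrite [c ^+ 2 *: V1](_ : _ = (4^-1 * 4 * c ^+ 2) *: V1); last first.
  by rewrite mulVf// mul1r.
have JJ' (X : 'M[K]_n) : X *m J *m J = X by rewrite -mulmxA JJ mulmx1.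
have JV' (X : 'M[K]_n) : X *m J *m V = - (X *m V *m J).
  by rewrite -mulmxA JV mulmxN mulmxA.
have JV1' (X : 'M[K]_n) : X *m J *m V1 = - (X *m V1 *m J).
  by rewrite -mulmxA JV1 mulmxN mulmxA.
have JV2' (X : 'M[K]_n) : X *m J *m V2 = - (X *m V2 *m J).
  by rewrite -mulmxA JV2 mulmxN mulmxA.
rewrite /F /G !(mulmxDl, mulmxDr, mulmxN, mulNmx, =^~ scalemxAl, =^~ scalemxAr) !mulmxA.
rewrite !(JJ', JV', JV1', JV2', JJ, JV, JV1, JV2, mulNmx, mulmxN).
apply/matrixP => i j.
have addE (A B : 'M[K]_n) : (A + B) i j = A i j + B i j by rewrite mxE.
have oppE (A : 'M[K]_n) : (- A) i j = - A i j by rewrite mxE.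
have scaleE a (A : 'M[K]_n) : (a *: A) i j = a * A i j by rewrite mxE.
rewrite !(addE, oppE, scaleE) half.
move: 4^-1 => q; ring.
Qed.

Lemma jmxK : jmx R p *m jmx R p = 1%:M.
Proof.
rewrite /jmx mulmx_block !mulmx0 !mul0mx !mulmx1 mulmxN mulmx1 opprK.
by rewrite !addr0 !add0r -scalar_mx_block.
Qed.

Lemma jmx_potential (v : 'M[C]_p) :
  jmx R p *m potential v = - (potential v *m jmx R p).
Proof.
rewrite /jmx /potential !mulmx_block !(mulmx0, mul0mx, mulmx1, mul1mx, mulmxN, mulNmx).
by rewrite opp_block_mx !(oppr0, opprK, addr0, add0r).
Qed.

Lemma ctrD m n (A B : 'M[C]_(m, n)) : (A + B)^t* = A^t* + B^t*.
Proof. by rewrite linearD map_mxD. Qed.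

Lemma ctrM m n q (A : 'M[C]_(m, n)) (B : 'M[C]_(n, q)) :
  (A *m B)^t* = B^t* *m A^t*.
Proof. by rewrite trmx_mul map_mxM. Qed.

Lemma ctr_realZ m n (k : R) (A : 'M[C]_(m, n)) : (k%:C *: A)^t* = k%:C *: A^t*.
Proof.
apply/matrixP => i j; rewrite !mxE rmorphM; congr (_ * _).
by apply/eqP; rewrite eq_complex cRe_conj cIm_conj /= oppr0 !eqxx.
Qed.

Lemma potentialD (v w : 'M[C]_p) : potential (v + w) = potential v + potential w.
Proof. by rewrite /potential add_block_mx !addr0 ctrD opprD. Qed.

Lemma potentialN (v : 'M[C]_p) : potential (- v) = - potential v.
Proof. by rewrite /potential opp_block_mx !oppr0 !linearN/= map_mxN. Qed.

Lemma potential_realZ (k : R) (v : 'M[C]_p) :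
  potential (k%:C *: v) = k%:C *: potential v.
Proof. by rewrite /potential scale_block_mx !scaler0 scalerN ctr_realZ. Qed.

Lemma potential_natZ k (v : 'M[C]_p) :
  potential (k%:R *: v) = k%:R *: potential v.
Proof. by rewrite -(rmorph_nat (@real_complex R)) potential_realZ. Qed.

Lemma antidiag_mul3 (a b c d e f : 'M[C]_p) :
  block_mx 0 a b 0 *m block_mx 0 c d 0 *m block_mx 0 e f 0 =
  block_mx 0 (a *m d *m e) (b *m c *m f) 0.
Proof. by rewrite !mulmx_block !(mulmx0, mul0mx, addr0, add0r). Qed.

(** The mKdV equation in terms of potentials. The sign changes because the
    diagonal blocks of V^2 are - v v^* and - v^* v. *)
Lemma potential_mkdv (v vx vt vxxx : 'M[C]_p) :
  4 *: vt = vxxx + 3 *: (vx *m v^t* *m v + v *m v^t* *m vx) ->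
  potential vt = 4^-1 *: (potential vxxx -
    3 *: (potential vx *m potential v *m potential v
          + potential v *m potential v *m potential vx)).
Proof.
move=> mkdv; apply: (scalerI (_ : (4 : C) != 0)); first by rewrite pnatr_eq0.
rewrite scalerA mulfV ?pnatr_eq0// scale1r -potential_natZ mkdv potentialD; congr (_ + _).
rewrite potential_natZ -scalerN; congr (_ *: _).
rewrite /potential !antidiag_mul3 add_block_mx opp_block_mx !addr0 !oppr0.
rewrite ctrD !ctrM !trmxCK; move: (v^t*) (vx^t*) => w wx.
rewrite !(mulmxN, mulNmx) !opprD !opprK !mulmxA; congr (block_mx _ _ _ _).
by rewrite addrC.
Qed.

Lemma mx_deriv_within_potential S (f : R -> 'M[C]_p) x L :
  mx_deriv_within S f x L ->
  mx_deriv_within S (fun y => potential (f y)) x (potential L).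
Proof.
move=> fL; apply: mx_deriv_within_block => //; try exact: mx_deriv_within_cst.
by apply: mx_deriv_withinN; exact: mx_deriv_within_ctr.
Qed.

(** In the variable c = i z the coefficients of F lose their imaginary units:
    - i z^3 = c^3 and - z^2 = c^2. *)
Lemma FmxE (v vx vxx : 'M[C]_p) (z : C) (c := 'i%C * z) :
  Fmx v vx vxx z = c ^+ 3 *: jmx R p + c ^+ 2 *: potential v
    - (c / 2) *: (potential v *m potential v *m jmx R p + potential vx *m jmx R p)
    + 4^-1 *: (potential vxx - 2 *: (potential v *m potential v *m potential v)
               - potential vx *m potential v + potential v *m potential vx).
Proof.
have i2 : 'i%C ^+ 2 = -1 :> C := sqr_i R.
have c3 : - ('i%C * z ^+ 3) = c ^+ 3.
  by rewrite /c exprMn (exprSr 'i%C 2) i2 mulN1r mulNr.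
have c2 : - z ^+ 2 = c ^+ 2 by rewrite /c exprMn i2 mulN1r.
by rewrite /Fmx c3 -scaleNr c2.
Qed.

Lemma mx_deriv_within_Fmx S (v vx vxx : R -> 'M[C]_p) (z : C) x v' vx' vxx' :
  mx_deriv_within S v x v' -> mx_deriv_within S vx x vx' ->
  mx_deriv_within S vxx x vxx' ->
  mx_deriv_within S (fun y => Fmx (v y) (vx y) (vxx y) z) x
   (let c := 'i%C * z in let V := potential (v x) in let V1 := potential (vx x) in
    let V' := potential v' in let V1' := potential vx' in let V2' := potential vxx' in
    let J := jmx R p in
    c ^+ 2 *: V' - (c / 2) *: ((V' *m V + V *m V') *m J + V1' *m J)
    + 4^-1 *: (V2' - 2 *: ((V' *m V + V *m V') *m V + V *m V *m V')
      - (V1' *m V + V1 *m V') + (V' *m V1 + V *m V1'))).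
Proof.
move=> /mx_deriv_within_potential dV /mx_deriv_within_potential dV1
  /mx_deriv_within_potential dV2 /=.
under eq_fun do rewrite FmxE.
have dVV := mx_deriv_withinM dV dV.
apply: mx_deriv_withinD; first apply: mx_deriv_withinD.
- rewrite -[X in mx_deriv_within _ _ _ X]add0r.
  by apply: mx_deriv_withinD; [exact: mx_deriv_within_cst|exact: mx_deriv_withinZ].
- apply/mx_deriv_withinN/mx_deriv_withinZ/mx_deriv_withinD; exact: mx_deriv_withinMr.
- apply/mx_deriv_withinZ/mx_deriv_withinD; last exact: mx_deriv_withinM.
  apply: mx_deriv_withinD; last by apply/mx_deriv_withinN/mx_deriv_withinM.
  apply: mx_deriv_withinD => //.
  by apply/mx_deriv_withinN/mx_deriv_withinZ/mx_deriv_withinM.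
Qed.

(** F_x = G_t + G F - F G, where G_t is the potential of v_t. This is the
    compatibility condition of the systems Y_x = G Y and Y_t = F Y. *)
Lemma zero_curvature S (v vx vxx : R -> 'M[C]_p) (z : C) x vt vxxx :
  mx_deriv_within S v x (vx x) -> mx_deriv_within S vx x (vxx x) ->
  mx_deriv_within S vxx x vxxx ->
  4 *: vt = vxxx + 3 *: (vx x *m (v x)^t* *m v x + v x *m (v x)^t* *m vx x) ->
  let F y := Fmx (v y) (vx y) (vxx y) z in
  mx_deriv_within S F x
    (potential vt + Gmx (v x) z *m F x - F x *m Gmx (v x) z).
Proof.
move=> dv dvx dvxx mkdv F.
have := mx_deriv_within_Fmx z dv dvx dvxx.
rewrite /=; set D := (X in mx_deriv_within _ _ _ X -> _).
suff -> : potential vt + Gmx (v x) z *m F x - F x *m Gmx (v x) z = D by [].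
have E := commutator_identity (potential vxxx) ('i%C * z) jmxK (jmx_potential (v x))
  (jmx_potential (vx x)) (jmx_potential (vxx x)).
cbv zeta in E.
rewrite (potential_mkdv mkdv).
rewrite -E.
rewrite /F FmxE.
cbv zeta.
rewrite /Gmx.
have cancel (a b c : 'M[C]_(p + p)) : a + b - c + c - b = a by rewrite subrK addrK.
etransitivity; first exact: cancel.
rewrite /D !mulmxDl.
congr (_ + 4^-1 *: _).
have swap (a b c d : 'M[C]_(p + p)) : a - b + c = a - (b + d) + (d + c).
  by rewrite opprD !addrA addrNK.
exact: swap.
Qed.


End ZeroCurvature.

(** * Linear systems and uniformity on compact intervals *)

Section LinearSystems.
Variable R : realType.
Local Notation C := R[i].

(** Gronwall for the squared norm: its derivative 2 <y, A y + r> is at most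
    (2 + |A|^2) |y|^2 + |r|^2. *)
Lemma sq_linear_ode_le (a b : R) n q (y : R -> 'M[C]_(n, q)) (A : R -> 'M[C]_n)
    (r : R -> 'M[C]_(n, q)) (K rho : R) : a <= b ->
  (forall x, x \in `[a, b] ->
    mx_deriv_within `[a, b] y x (A x *m y x + r x)) ->
  (forall x, x \in `[a, b] -> sq (A x) <= K) ->
  (forall x, x \in `[a, b] -> sq (r x) <= rho) ->
  sq (y b) <= expR ((2 + K) * (b - a)) * (sq (y a) + rho * (b - a)).
Proof.
move=> ab dy AK rrho; have aab : a \in `[a, b] by rewrite in_itv/= lexx.
have K0 : 0 <= K := le_trans (sq_ge0 _) (AK a aab).
have rho0 : 0 <= rho := le_trans (sq_ge0 _) (rrho a aab).
apply: (@gronwall _ a b ab (fun x => sq (y x))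
  (fun x => 2 * dot (y x) (A x *m y x + r x))) => //.
- by rewrite addr_ge0.
- by move=> x xab; apply: deriv_within_sq; exact: dy.
- move=> x xab; rewrite dotDr.
  have := dot_le_sq (y x) (A x *m y x); have := dot_le_sq (y x) (r x).
  have := sqM_le (A x) (y x); have := ler_wpM2r (sq_ge0 (y x)) (AK x xab).
  have := rrho x xab; lra.
Qed.

Lemma sq_linear_ode_ge (a b : R) n q (y : R -> 'M[C]_(n, q)) (A : R -> 'M[C]_n)
    (K : R) : a <= b ->
  (forall x, x \in `[a, b] -> mx_deriv_within `[a, b] y x (A x *m y x)) ->
  (forall x, x \in `[a, b] -> sq (A x) <= K) ->
  sq (y a) <= expR ((1 + K) * (b - a)) * sq (y b).
Proof.
move=> ab dy AK.
apply: (@gronwall_backward _ a b ab (fun x => sq (y x))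
  (fun x => 2 * dot (y x) (A x *m y x)) (1 + K)).
- by move=> x xab; apply: deriv_within_sq; exact: dy.
- move=> x xab; have := dot_ge_sq (y x) (A x *m y x).
  have := sqM_le (A x) (y x); have := ler_wpM2r (sq_ge0 (y x)) (AK x xab); lra.
Qed.

End LinearSystems.

Section LocalUniformity.
Variables (R : realType) (a : R).
Local Notation C := R[i].
Let D := [set q : R * R | 0 <= q.1 /\ 0 <= q.2 < a].

(** Compactness of [0, X]: continuity at (x, s) controls g on a rectangle
    around (x, s), and finitely many such rectangles cover [0, X] x {s}. *)
Lemma uniform_continuity_slice (g : R * R -> R) (s X e : R) :
  {within D, continuous g} -> 0 <= s < a -> 0 < e ->
  \forall t \near s, 0 <= t < a ->
    forall x, x \in `[0, X] -> `|g (x, t) - g (x, s)| <= e.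
Proof.
move=> /subspace_continuousP gc sa e0.
have /compact_near_coveringP/near_covering_withinP cov := @segment_compact R 0 X.
have := cov R (nbhs s) (fun t x => 0 <= t < a -> `|g (x, t) - g (x, s)| <= e).
move=> /(_ _ _) H.
have {}H : \forall t \near s, `[0, X] `<=`
    (fun x => 0 <= t < a -> `|g (x, t) - g (x, s)| <= e).
  apply: H => x x0X.
  have Dxs : D (x, s) by split=> //=; case/andP: x0X.
  have e20 : 0 < e / 2 by rewrite divr_gt0.
  have /cvgrPdist_le/(_ _ e20) := gc _ Dxs.
  rewrite /prop_near1 /within /= => -[[Q1 Q2] [/= Q1x Q2s] sub].
  exists (Q1, Q2) => //= -[x' t] /= [Q1x' Q2t] x'0X ta.
  have x'0 : 0 <= x' by case/andP: x'0X.
  have h1 : `|g (x, s) - g (x', t)| <= e / 2 by apply: (sub (x', t)).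
  have h2 : `|g (x, s) - g (x', s)| <= e / 2.
    by apply: (sub (x', s)) => //; split=> //=; exact: nbhs_singleton.
  rewrite (_ : _ - _ = (g (x, s) - g (x', s)) - (g (x, s) - g (x', t))); last by ring.
  by rewrite (le_trans (ler_normB _ _))// (splitr e) lerD.
by apply: filterS H => t H ta x x0X; exact: H.
Qed.

(** A derivative e-close to l forces increments e-close to those of a linear
    function of slope l, since both (l + e) y - f(y) and f(y) - (l - e) y are
    nondecreasing. *)
Lemma mean_value_le (b c : R) (f f' : R -> R) (l e : R) : b <= c ->
  (forall x, x \in `[b, c] -> deriv_within `[b, c] f x (f' x)) ->
  (forall x, x \in `[b, c] -> `|f' x - l| <= e) ->
  `|f c - f b - l * (c - b)| <= e * (c - b).
Proof.
move=> bc df f'l.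
have did k x : deriv_within `[b, c] (fun y => k * y) x k.
  have := deriv_withinM (deriv_within_cst `[b, c] k x)
    (deriv_within_is_derive `[b, c] (is_derive_id x 1)).
  by rewrite mul0r add0r mulr1.
have := @deriv_within_ge0 _ b c (fun y => (l + e) * y + - f y)
  (fun y => (l + e) + - f' y) bc.
move=> /(_ _ _) H1.
have {}H1 : (l + e) * b + - f b <= (l + e) * c + - f c.
  apply: H1 => x xbc.
    by apply: deriv_withinD; [exact: did|apply: deriv_withinN; exact: df].
  by have := f'l x xbc; rewrite ler_distl; lra.
have := @deriv_within_ge0 _ b c (fun y => (e - l) * y + f y)
  (fun y => (e - l) + f' y) bc.
move=> /(_ _ _) H2.
have {}H2 : (e - l) * b + f b <= (e - l) * c + f c.
  apply: H2 => x xbc.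
    by apply: deriv_withinD; [exact: did|exact: df].
  by have := f'l x xbc; rewrite ler_distl; lra.
rewrite ler_norml; apply/andP; split; lra.
Qed.

(** The first-order expansion in t is uniform in x in [0, X], because the
    t-derivative is uniformly close to its value at s. *)
Lemma uniform_differentiability_slice (g g' : R -> R -> R) (s X e : R) :
  (forall x t, 0 <= x -> 0 <= t < a -> deriv_within `[0, a[ (g x) t (g' x t)) ->
  {within D, continuous (fun q => g' q.1 q.2)} -> 0 <= s < a -> 0 < e ->
  \forall t \near s, 0 <= t < a -> forall x, x \in `[0, X] ->
    `|g x t - g x s - g' x s * (t - s)| <= e * `|t - s|.
Proof.
move=> dg g'c sa e0.
have /nbhs_ballP[d /= d0 dP] := uniform_continuity_slice X g'c sa e0.
apply/nbhs_ballP; exists d => //= t; rewrite /ball /= => std ta x x0X.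
have x0 : 0 <= x by case/andP: x0X.
have sub b c : 0 <= b -> c < a -> `[b, c] `<=` `[0, a[.
  move=> b0 ca y /=; rewrite !in_itv/= => /andP[by1 yc].
  by rewrite (le_trans b0 by1) (le_lt_trans yc ca).
have [s0 sa'] := andP sa; have [t0 ta'] := andP ta.
have near_s y : `|s - y| <= `|s - t| -> 0 <= y < a -> `|g' x y - g' x s| <= e.
  by move=> sy ya; apply: (dP y) => //; rewrite /ball /=; exact: le_lt_trans sy std.
have [st|ts] := leP s t.
  rewrite [X in _ <= _ * X]ger0_norm ?subr_ge0//.
  apply: (@mean_value_le _ _ (g x) (g' x)) => // y yst.
    apply: (deriv_withinS (sub _ _ s0 ta')); apply: dg => //.
    by have := sub _ _ s0 ta' y yst; rewrite /= in_itv.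
  have ya : 0 <= y < a by have := sub _ _ s0 ta' y yst; rewrite /= in_itv.
  apply: near_s => //; move: yst; rewrite in_itv/= => /andP[sy yt].
  by rewrite distrC (distrC s) !ger0_norm ?subr_ge0// lerD2r.
rewrite [X in _ <= _ * X]ltr0_norm ?subr_lt0// opprB.
rewrite (_ : _ - _ - _ = - (g x s - g x t - g' x s * (s - t))); last by ring.
rewrite normrN; apply: (@mean_value_le _ _ (g x) (g' x)) (ltW ts) _ _ => // y yst.
  apply: (deriv_withinS (sub _ _ t0 sa')); apply: dg => //.
  by have := sub _ _ t0 sa' y yst; rewrite /= in_itv.
have ya : 0 <= y < a by have := sub _ _ t0 sa' y yst; rewrite /= in_itv.
apply: near_s => //; move: yst; rewrite in_itv/= => /andP[ty ys].
by rewrite !ger0_norm ?subr_ge0// ?(ltW ts)// lerD2l lerN2.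
Qed.

Lemma uniform_continuity_mx m n (f : R -> R -> 'M[C]_(m, n)) (s X e : R) :
  mx_continuous_within D f -> 0 <= s < a -> 0 < e ->
  \forall t \near s, 0 <= t < a ->
    forall x, x \in `[0, X] -> sq (f x t - f x s) <= e.
Proof.
move=> fc sa e0; have [d d0 dle] := small_entry_bound m n e0.
have H0 (ij : 'I_m * 'I_n) : \forall t \near s, 0 <= t < a ->
    forall x, x \in `[0, X] -> `|complex.Re ((f x t - f x s) ij.1 ij.2)| <= d /\
      `|complex.Im ((f x t - f x s) ij.1 ij.2)| <= d.
  case: ij => i j /=; have [fr fi] := fc i j.
  have := uniform_continuity_slice X fr sa d0.
  have := uniform_continuity_slice X fi sa d0.
  apply: filterS2 => t hi hr ta x x0X; rewrite !mxE cReD cImD cReN cImN.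
  by split; [exact: hr|exact: hi].
have H : \forall t \near s, forall ij : 'I_m * 'I_n, 0 <= t < a ->
    forall x, x \in `[0, X] -> `|complex.Re ((f x t - f x s) ij.1 ij.2)| <= d /\
      `|complex.Im ((f x t - f x s) ij.1 ij.2)| <= d.
  exact: (filter_forall (F := nbhs s) _ H0).
apply: filterS H => t H ta x x0X; apply: le_trans dle.
by apply: sq_le_entries => [|i j]; [exact: ltW|exact: (H (i, j))].
Qed.

Lemma uniform_differentiability_mx m n (f f' : R -> R -> 'M[C]_(m, n)) (s X e : R) :
  (forall x t, 0 <= x -> 0 <= t < a -> mx_deriv_within `[0, a[ (f x) t (f' x t)) ->
  mx_continuous_within D f' -> 0 <= s < a -> 0 < e ->
  \forall t \near s, 0 <= t < a -> forall x, x \in `[0, X] ->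
    sq (f x t - f x s - (t - s)%:C *: f' x s) <= e * (t - s) ^+ 2.
Proof.
move=> df f'c sa e0; have [d d0 dle] := small_entry_bound m n e0.
have H0 (ij : 'I_m * 'I_n) : \forall t \near s, 0 <= t < a ->
    forall x, x \in `[0, X] ->
      `|complex.Re ((f x t - f x s - (t - s)%:C *: f' x s) ij.1 ij.2)| <= d * `|t - s| /\
      `|complex.Im ((f x t - f x s - (t - s)%:C *: f' x s) ij.1 ij.2)| <= d * `|t - s|.
  case: ij => i j /=; have [fr fi] := f'c i j.
  have := uniform_differentiability_slice X
    (fun x t x0 ta => (df x t x0 ta i j).1) fr sa d0.
  have := uniform_differentiability_slice X
    (fun x t x0 ta => (df x t x0 ta i j).2) fi sa d0.
  apply: filterS2 => t hi hr ta x x0X; rewrite !mxE !(cReD, cImD, cReN, cImN, cReM, cImM)/=.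
  rewrite !mul0r subr0 addr0 !(mulrC (t - s)).
  by split; [exact: hr|exact: hi].
have H : \forall t \near s, forall ij : 'I_m * 'I_n, 0 <= t < a ->
    forall x, x \in `[0, X] ->
      `|complex.Re ((f x t - f x s - (t - s)%:C *: f' x s) ij.1 ij.2)| <= d * `|t - s| /\
      `|complex.Im ((f x t - f x s - (t - s)%:C *: f' x s) ij.1 ij.2)| <= d * `|t - s|.
  exact: (filter_forall (F := nbhs s) _ H0).
apply: filterS H => t H ta x x0X.
apply: (@le_trans _ _ (2 * (d * `|t - s|) ^+ 2 * (m * n)%:R)).
  by apply: sq_le_entries => [|i j]; [rewrite mulr_ge0// ltW|exact: (H (i, j))].
by rewrite exprMn real_normK ?num_real// mulrA mulrAC ler_wpM2r ?sqr_ge0.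
Qed.

End LocalUniformity.

(** * Propagation of the Dirac solutions in time *)

Section BoundedFamilies.
Variables (R : realType) (T : Type) (P : set T).
Local Notation C := R[i].

(** Boundedness in any of the equivalent matrix norms. *)
Definition sq_bounded m n (A : T -> 'M[C]_(m, n)) : Prop :=
  exists K, forall t, P t -> sq (A t) <= K.

Lemma sq_bounded_cst m n (A : 'M[C]_(m, n)) : sq_bounded (fun=> A).
Proof. by exists (sq A). Qed.

Lemma sq_boundedD m n (A B : T -> 'M[C]_(m, n)) :
  sq_bounded A -> sq_bounded B -> sq_bounded (fun t => A t + B t).
Proof.
move=> [K AK] [L BL]; exists (2 * K + 2 * L) => t Pt.
apply: le_trans (sqD_le _ _) _.
by apply: lerD; apply: ler_wpM2l => //; [exact: AK|exact: BL].
Qed.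

Lemma sq_boundedM m n q (A : T -> 'M[C]_(m, n)) (B : T -> 'M[C]_(n, q)) :
  sq_bounded A -> sq_bounded B -> sq_bounded (fun t => A t *m B t).
Proof.
move=> [K AK] [L BL]; exists (K * L) => t Pt; apply: le_trans (sqM_le _ _) _.
by apply: ler_pM; rewrite ?sq_ge0 ?AK ?BL.
Qed.

Lemma sq_boundedZ m n c (A : T -> 'M[C]_(m, n)) :
  sq_bounded A -> sq_bounded (fun t => c *: A t).
Proof.
move=> [K AK]; exists (modsq c * K) => t Pt.
by rewrite sqZ ler_wpM2l ?modsq_ge0 ?AK.
Qed.

Lemma sq_boundedN m n (A : T -> 'M[C]_(m, n)) :
  sq_bounded A -> sq_bounded (fun t => - A t).
Proof. by move=> [K AK]; exists K => t Pt; rewrite sqN AK. Qed.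

Lemma sq_potential p (v : 'M[C]_p) : sq (potential v) = 2 * sq v.
Proof. by rewrite sq_block_mx !sq0 sqN sq_ctr; ring. Qed.

Lemma sq_bounded_potential p (v : T -> 'M[C]_p) :
  sq_bounded v -> sq_bounded (fun t => potential (v t)).
Proof.
by move=> [K vK]; exists (2 * K) => t Pt; rewrite sq_potential ler_wpM2l ?vK.
Qed.

Lemma sq_bounded_Gmx p (v : T -> 'M[C]_p) z :
  sq_bounded v -> sq_bounded (fun t => Gmx (v t) z).
Proof.
move=> vb; apply: sq_boundedD; first exact: sq_bounded_cst.
exact: sq_bounded_potential.
Qed.

Lemma sq_bounded_Fmx p (v vx vxx : T -> 'M[C]_p) z :
  sq_bounded v -> sq_bounded vx -> sq_bounded vxx ->
  sq_bounded (fun t => Fmx (v t) (vx t) (vxx t) z).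
Proof.
move=> /sq_bounded_potential bV /sq_bounded_potential bV1 /sq_bounded_potential bV2.
have bJ := sq_bounded_cst (jmx R p).
have bVV := sq_boundedM bV bV.
apply: sq_boundedD; first apply: sq_boundedD; first apply: sq_boundedD.
- exact: sq_bounded_cst.
- exact/sq_boundedN/sq_boundedZ.
- apply/sq_boundedN/sq_boundedZ/sq_boundedD; exact: sq_boundedM.
- apply/sq_boundedZ/sq_boundedD; last exact: sq_boundedM.
  apply: sq_boundedD; last by apply/sq_boundedN/sq_boundedM.
  apply: sq_boundedD; first exact: bV2.
  exact/sq_boundedN/sq_boundedZ/sq_boundedM.
Qed.

End BoundedFamilies.

(** The x-derivative of the remainder D = Z' - Z - k F Z of a first-order
    expansion in t, where Z and Z' solve the systems with matrices G and G' at
    times that differ by k, and where F_x = Vt + G F - F G: it is G' D plus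
    terms that are small when V' - V is well approximated by k Vt. *)
Lemma defect_identity (K : comNzRingType) n q (J V V' Vt F : 'M[K]_n)
    (Z Z' : 'M[K]_(n, q)) (k : K) (G := J + V) (G' := J + V') :
  G' *m Z' - G *m Z - k *: ((Vt + G *m F - F *m G) *m Z + F *m (G *m Z)) =
  G' *m (Z' - Z - k *: (F *m Z)) +
  ((V' - V - k *: Vt) *m Z + k *: ((V' - V) *m (F *m Z))).
Proof.
have -> : V' - V = G' - G by rewrite /G /G' opprD addrACA subrr add0r.
move: G G' => {}G {}G'.
rewrite !(mulmxDl, mulmxDr, mulNmx, mulmxN) -!scalemxAr -!scalemxAl !mulmxA.
rewrite -!scaleNr.
move: (G' *m Z') (G' *m Z) (G *m Z) (G' *m F *m Z) (G *m F *m Z) (F *m G *m Z) (Vt *m Z).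
move=> a b c d e f g; apply/matrixP => i j; rewrite !mxE; ring.
Qed.

Section TimeEvolution.
Variables (R : realType) (p q : nat) (a : R).
Local Notation C := R[i].
Let D := [set q : R * R | 0 <= q.1 /\ 0 <= q.2 < a].
Variables (v vx vt vxx vxxx : R -> R -> 'M[C]_p) (z : C).
Hypothesis v_derivs : forall x t, D (x, t) ->
  [/\ mx_deriv_within `[0, +oo[ (v^~ t) x (vx x t),
      mx_deriv_within `[0, a[ (v x) t (vt x t),
      mx_deriv_within `[0, +oo[ (vx^~ t) x (vxx x t) &
      mx_deriv_within `[0, +oo[ (vxx^~ t) x (vxxx x t)].
Hypothesis v_cont : mx_continuous_within D v.
Hypothesis vt_cont : mx_continuous_within D vt.
Hypothesis mkdv : forall x t, D (x, t) ->
  4 *: vt x t = vxxx x t + 3 *: (vx x t *m (v x t)^t* *m v x t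
                                 + v x t *m (v x t)^t* *m vx x t).
Local Notation G := (fun q : R * R => Gmx (v q.1 q.2) z).
Local Notation F := (fun q : R * R => Fmx (v q.1 q.2) (vx q.1 q.2) (vxx q.1 q.2) z).
Hypothesis G_bounded : sq_bounded D G.
Hypothesis F_bounded : sq_bounded D F.

Variable Y : R -> R -> 'M[C]_(p + p, q).
Hypothesis Y_x : forall x t, D (x, t) ->
  mx_deriv_within `[0, +oo[ (Y^~ t) x (G (x, t) *m Y x t).
Hypothesis Y_t0 : forall t, 0 <= t < a ->
  mx_deriv_within `[0, a[ (Y 0) t (F (0, t) *m Y 0 t).

(** The zero curvature equation propagates Y_t = F Y from x = 0 to all x. The
    remainder d = Y(x, s) - Y(x, t) - (s - t) F Y(x, t) of the expansion in time
    satisfies d_x = G d + r, where r is o(s - t) uniformly on [0, X], and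
    d = o(s - t) at x = 0; by Gronwall d = o(s - t) at x = X. Thus the
    regularity of Y in t is transported from x = 0. *)
Lemma Y_time_derivative x t : D (x, t) ->
  mx_deriv_within `[0, a[ (Y x) t (F (x, t) *m Y x t).
Proof.
move=> [/= X0 ta]; move: x X0 => X X0.
have [KG GK] := G_bounded; have [KF FK] := F_bounded.
have inD x s : x \in `[0, X] -> 0 <= s < a -> D (x, s).
  by move=> /andP[x0 _] sa; split.
have sub : `[0, X] `<=` `[0, +oo[ by move=> y /=; rewrite !in_itv/= => /andP[->].
have D0 : D (0, t) by split.
have KG0 : 0 <= KG by exact: le_trans (sq_ge0 _) (GK _ D0).
have KF0 : 0 <= KF by exact: le_trans (sq_ge0 _) (FK _ D0).
(* A bound of Y(., t) on [0, X], from Y_x = G Y. *)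
pose KY := expR ((2 + KG) * X) * sq (Y 0 t).
have YK x : x \in `[0, X] -> sq (Y x t) <= KY.
  move=> x0X; have [x0 xX] := andP (x0X : (0 <= x) && (x <= X)).
  have := @sq_linear_ode_le _ 0 x _ _ (Y^~ t) (fun y => G (y, t)) (fun=> 0) KG 0 x0.
  have subx : `[0, x] `<=` `[0, X].
    by move=> y /=; rewrite !in_itv/= => /andP[-> yx]; exact: le_trans yx xX.
  move=> /(_ _ _ _) H; apply: (le_trans (H _ _ _)).
  - move=> y yx; rewrite addr0; apply: (mx_deriv_withinS (subset_trans subx sub)).
    by apply: Y_x; apply: inD => //; exact: subx.
  - by move=> y yx; apply: GK; apply: inD => //; exact: subx.
  - by move=> y _; rewrite sq0.
  rewrite mul0r addr0 subr0 ler_wpM2r ?sq_ge0// ler_expR ler_wpM2l//.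
  exact: addr_ge0.
have KY0 : 0 <= KY by rewrite mulr_ge0 ?expR_ge0 ?sq_ge0.
apply/mx_deriv_withinP => e e0.
(* The factor by which the estimates below lose; h compensates for it. *)
pose c := expR ((2 + KG) * X) * (1 + 2 * KY * (1 + KF) * X).
have c0 : 0 < c.
  have : 0 <= 2 * KY * (1 + KF) * X.
    by apply: mulr_ge0 => //; apply: mulr_ge0; [exact: mulr_ge0|exact: addr_ge0].
  by move=> ?; apply: mulr_gt0; [exact: expR_gt0|exact: ltr_wpDr].
pose h := e / c; have h0 : 0 < h by rewrite divr_gt0.
have half2 : h = 2 * (h / 2) by rewrite [RHS]mulrC divfK.
have h20 : 0 < h / 2 by rewrite divr_gt0.
have /mx_deriv_withinP/(_ _ h0) near0 := Y_t0 ta.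
have near1 := uniform_continuity_mx X v_cont ta h20.
have v_t y s : 0 <= y -> 0 <= s < a -> mx_deriv_within `[0, a[ (v y) s (vt y s).
  by move=> y0 sa; case: (@v_derivs y s).
have near2 := uniform_differentiability_mx X v_t vt_cont ta h20.
near=> s => sa'.
have sa : 0 <= s < a by move: sa'; rewrite /= in_itv.
pose k := s - t.
have vs y : y \in `[0, X] -> sq (v y s - v y t) <= h / 2.
  by apply: (near near1 s).
have vs' y : y \in `[0, X] -> sq (v y s - v y t - k%:C *: vt y t) <= h / 2 * k ^+ 2.
  by apply: (near near2 s).
have Ys0 : sq (Y 0 s - Y 0 t - k%:C *: (F (0, t) *m Y 0 t)) <= h * k ^+ 2.
  by apply: (near near0 s).
pose d y := Y y s - Y y t - k%:C *: (F (y, t) *m Y y t).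
pose r y := potential (v y s - v y t - k%:C *: vt y t) *m Y y t +
  k%:C *: (potential (v y s - v y t) *m (F (y, t) *m Y y t)).
have dd y : y \in `[0, X] ->
    mx_deriv_within `[0, X] d y (G (y, s) *m d y + r y).
  move=> yX; have Dt := inD _ _ yX ta; have Ds := inD _ _ yX sa.
  have [dv _ dvx dvxx] := v_derivs Dt.
  have dF := zero_curvature z dv dvx dvxx (mkdv Dt).
  have dFY := mx_deriv_withinM dF (Y_x Dt).
  have := mx_deriv_withinD (mx_deriv_withinD (Y_x Ds) (mx_deriv_withinN (Y_x Dt)))
    (mx_deriv_withinN (mx_deriv_withinZ k%:C dFY)).
  move=> /(mx_deriv_withinS sub); rewrite -/(d y).
  set L := (X in mx_deriv_within _ _ _ X -> _).
  suff -> : L = G (y, s) *m d y + r y by [].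
  rewrite /L /r /d /= /Gmx !potentialD !potentialN potential_realZ.
  exact: defect_identity.
have rr y : y \in `[0, X] -> sq (r y) <= 2 * KY * (1 + KF) * (h * k ^+ 2).
  move=> yX; have k0 : 0 <= k ^+ 2 by exact: sqr_ge0.
  have modk : modsq k%:C = k ^+ 2 by rewrite /modsq /= expr0n addr0.
  apply: le_trans (sqD_le _ _) _; rewrite sqZ modk.
  have F1 : sq (F (y, t)) <= KF by apply: FK; apply: inD.
  have Y1 := YK y yX.
  have FY1 : sq (F (y, t) *m Y y t) <= KF * KY.
    by apply: le_trans (sqM_le _ _) _; apply: ler_pM; rewrite ?sq_ge0.
  have E1 : sq (potential (v y s - v y t - k%:C *: vt y t) *m Y y t) <= h * k ^+ 2 * KY.
    apply: le_trans (sqM_le _ _) _; apply: ler_pM; rewrite ?sq_ge0// sq_potential.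
    by rewrite [h]half2 -mulrA ler_wpM2l// vs'.
  have E2 : sq (potential (v y s - v y t) *m (F (y, t) *m Y y t)) <= h * (KF * KY).
    apply: le_trans (sqM_le _ _) _; apply: ler_pM; rewrite ?sq_ge0// sq_potential.
    by rewrite [leRHS]half2 ler_wpM2l// vs.
  rewrite (_ : 2 * KY * _ * _ =
    2 * (h * k ^+ 2 * KY) + 2 * (k ^+ 2 * (h * (KF * KY)))); last by ring.
  by apply: lerD; apply: ler_wpM2l => //; exact: ler_wpM2l.
have := sq_linear_ode_le X0 dd (fun y yX => GK (y, s) (inD y s yX sa)) rr.
rewrite subr0 -/k -/(d X); move=> H; apply: le_trans H _.
have -> : e * k ^+ 2 = c * (h * k ^+ 2).
  have ch : c * h = e by rewrite /h mulrC divfK ?gt_eqF.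
  by rewrite -{1}ch -(mulrA c).
rewrite /c -[X in _ <= X]mulrA ler_wpM2l ?expR_ge0//.
by rewrite [X in _ <= X]mulrDl mul1r [X in _ <= _ + X]mulrAC lerD2r.
Unshelve. all: by end_near. Qed.

(** Gronwall in t at each x. The constant does not depend on x, because F is
    bounded on the whole domain; so square integrability in x is
    preserved along the flow. *)
Lemma Y_time_growth t : 0 <= t < a ->
  exists K, forall x, 0 <= x -> sq (Y x t) <= K * sq (Y x 0).
Proof.
move=> /andP[t0 ta]; have [KF FK] := F_bounded.
exists (expR ((2 + KF) * t)) => x x0.
have sub : `[0, t] `<=` `[0, a[.
  by move=> y /=; rewrite !in_itv/= => /andP[-> yt]; exact: le_lt_trans yt ta.
have inD s : s \in `[0, t] -> D (x, s).
  by move=> /sub; rewrite /= in_itv/= => sa; split.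
have := @sq_linear_ode_le _ 0 t _ _ (Y x) (fun s => F (x, s)) (fun=> 0) KF 0 t0.
rewrite mul0r addr0 subr0; apply.
- move=> s st; rewrite addr0; apply: (mx_deriv_withinS sub).
  by apply: Y_time_derivative; exact: inD.
- by move=> s /inD; exact: FK.
- by move=> s _; rewrite sq0.
Qed.

End TimeEvolution.

(** * Square integrability on the half-line *)

Section SquareIntegrability.
Variable R : realType.
Local Notation C := R[i].
Local Notation mu := (@lebesgue_measure R).

Definition integrable_halfline (f : R -> R) := mu.-integrable `[0, +oo[ (EFin \o f).

Lemma integrable_halflineD f g : integrable_halfline f -> integrable_halfline g ->
  integrable_halfline (fun x => f x + g x).
Proof.
move=> fi gi; have := integrableD _ fi gi; move=> /(_ (measurable_itv _)).
by apply: eq_integrable => // x _; rewrite /= EFinD.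
Qed.

Lemma integrable_halflineZ k f : integrable_halfline f ->
  integrable_halfline (fun x => k * f x).
Proof.
move=> fi; have := integrableZl _ k fi; move=> /(_ (measurable_itv _)).
by apply: eq_integrable => // x _; rewrite /= EFinM.
Qed.

Lemma integrable_halfline_sum n (f : 'I_n -> R -> R) :
  (forall i, integrable_halfline (f i)) ->
  integrable_halfline (fun x => \sum_i f i x).
Proof.
move=> fi.
have := integrable_sum _ (index_enum 'I_n) (fun i (_ : true) => fi i).
move=> /(_ (measurable_itv _)).
by apply: eq_integrable => // x _; rewrite /= -sumEFin.
Qed.

(** The half-line has infinite measure. *)
Lemma integrable_halfline_lower_bound c f : integrable_halfline f ->
  (forall x, 0 <= x -> c <= f x) -> c <= 0.
Proof.
move=> fi cf.
rewrite leNgt; apply/negP => c0.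
have := integrable_lty _ fi; move=> /(_ (measurable_itv _)).
apply/negP; rewrite -leNgt leye_eq.
have : (\int[mu]_(x in `[0%R, +oo[) cst c%:E x <= \int[mu]_(x in `[0%R, +oo[) (EFin \o f) x)%E.
  apply: ge0_le_integral => //.
  - by move=> x _; rewrite lee_fin ltW.
  - by have /integrableP[] := fi.
  - by move=> x; rewrite /= in_itv/= andbT => x0; rewrite lee_fin cf.
rewrite integral_cst//.
have mu_oo : (lebesgue_measure (`[0%R, +oo[ : set R) = +oo :> \bar R)%E.
  by rewrite lebesgue_measure_itv/= ltry.
rewrite [X in (_ * X <= _)%E -> _](_ : _ = +oo%E); last exact: mu_oo.
by rewrite gt0_muley ?lte_fin// leye_eq.
Qed.

Lemma integrable_halfline_sq m n (U : R -> 'M[C]_(m, n)) :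
  mx_integrable `[0, +oo[ (fun x => (U x)^t* *m U x) ->
  integrable_halfline (fun x => sq (U x)).
Proof.
move=> Ui.
rewrite (_ : (fun _ => _) = fun x => \sum_j complex.Re (((U x)^t* *m U x) j j)).
  by apply: integrable_halfline_sum => j; have [] := Ui j j.
by apply/funext => x; rewrite /sq /dot /mxtrace cRe_sum.
Qed.

End SquareIntegrability.

Section DiracUniqueness.
Variables (R : realType) (p : nat).
Local Notation C := R[i].

Lemma dotZ m n (c : C) (A : 'M[C]_(m, n)) : dot A (c *: A) = complex.Re c * sq A.
Proof.
rewrite /sq !dotE mulr_sumr; apply: eq_bigr => j _; rewrite mulr_sumr.
by apply: eq_bigr => i _; rewrite mxE cReM cImM; ring.
Qed.

Lemma dot_realZl m n (k : R) (A B : 'M[C]_(m, n)) : dot (k%:C *: A) B = k * dot A B.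
Proof.
rewrite !dotE mulr_sumr; apply: eq_bigr => j _; rewrite mulr_sumr.
by apply: eq_bigr => i _; rewrite mxE cReM cImM /=; ring.
Qed.

Lemma Gmx_col_mx q (v : 'M[C]_p) (z : C) (A B : 'M[C]_(p, q)) :
  Gmx v z *m col_mx A B =
  col_mx (('i%C * z) *: A + v *m B) (- (v^t* *m A) - ('i%C * z) *: B).
Proof.
rewrite /Gmx mulmxDl -scalemxAl /jmx /potential !mul_block_col.
rewrite !(mul0mx, mul1mx, addr0, add0r, mulNmx) scale_col_mx add_col_mx.
by rewrite scalerN [X in col_mx _ X]addrC.
Qed.

(** For u = col (A, B) the derivative of |A|^2 - |B|^2 is
    2 Re(i z) (|A|^2 + |B|^2) + 4 <A, v B>. Since Re(i z) = - Im z > M and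
    2 |<A, v B>| <= M (|A|^2 + |B|^2), it is nonnegative. This is where the
    half-plane Im z < - M comes from. *)
Lemma dirac_indefinite_form_ge q (v : R -> 'M[C]_p) (z : C) (M : R)
    (u : R -> 'M[C]_(p + p, q)) (X : R) : 0 < M -> 0 <= X ->
  complex.Im z < - M ->
  (forall x, 0 <= x -> opnorm (v x) <= M) ->
  (forall x, 0 <= x -> mx_deriv_within `[0, +oo[ u x (Gmx (v x) z *m u x)) ->
  sq (usubmx (u 0)) - sq (dsubmx (u 0)) <= sq (usubmx (u X)) - sq (dsubmx (u X)).
Proof.
move=> M0 X0 zM vM du.
have sub : `[0, X] `<=` `[0, +oo[ by move=> y /=; rewrite !in_itv/= => /andP[->].
pose c : C := 'i%C * z.
have cM : M < complex.Re c.
  by rewrite cReM /= mul0r mul1r add0r ltrNr.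
apply: (@deriv_within_ge0 _ 0 X (fun x => sq (usubmx (u x)) + - sq (dsubmx (u x)))
  (fun x => 2 * dot (usubmx (u x)) (usubmx (Gmx (v x) z *m u x)) +
          - (2 * dot (dsubmx (u x)) (dsubmx (Gmx (v x) z *m u x))))) => // x xX.
  have x0 : 0 <= x by case/andP: xX.
  have dx := mx_deriv_withinS sub (du x x0).
  apply: deriv_withinD; last apply: deriv_withinN; apply: deriv_within_sq.
    exact: mx_deriv_within_usubmx.
  exact: mx_deriv_within_dsubmx.
have x0 : 0 <= x by case/andP: xX.
rewrite -[u x]vsubmxK Gmx_col_mx !col_mxKu !col_mxKd -/c.
move: (usubmx _) (dsubmx _) => A B.
rewrite !dotDr !dotNr !dotZ dot_adj (dotC (v x *m B)).
have vB := opnorm_sqM_le B (vM x x0).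
have := dot_ge_sq (M%:C *: A) (v x *m B).
rewrite dot_realZl sqZ (_ : modsq _ = M ^+ 2); last by rewrite /modsq /= expr0n addr0.
move=> dAB.
(* dot_ge_sq was applied to M A and v B, to balance the two squares. *)
have {}dAB : - (M * (sq A + sq B)) <= 2 * dot A (v x *m B).
  rewrite -(ler_pM2l M0); lra.
have := ler_wpM2r (addr_ge0 (sq_ge0 A) (sq_ge0 B)) (ltW cM); lra.
Qed.

(** A solution that starts at col (g, 0) satisfies
    |u(x)|^2 >= |A|^2 - |B|^2 >= |g|^2 for all x, so it is dominated by an
    integrable function only if g = 0. Both the uniqueness of the Weyl
    function and the invertibility of the denominator of the linear
    fractional transformation follow. *)
Lemma decaying_solution_eq0 q (v : R -> 'M[C]_p) (z : C) (M : R)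
    (W : R -> 'M[C]_(p + p)) (g : 'M[C]_(p, q)) (f : R -> R) : 0 < M ->
  complex.Im z < - M ->
  (forall x, 0 <= x -> opnorm (v x) <= M) ->
  is_fundamental_solution v z W ->
  integrable_halfline f ->
  (forall x, 0 <= x -> sq (W x *m col_mx g 0) <= f x) -> g = 0.
Proof.
move=> M0 zM vM [W0 dW] fi Wf; apply: sq_eq0.
apply: (integrable_halfline_lower_bound fi) => x x0; apply: le_trans (Wf x x0).
have := @dirac_indefinite_form_ge q v z M (fun x => W x *m col_mx g 0) x M0 x0 zM vM.
rewrite W0 mul1mx col_mxKu col_mxKd sq0 subr0 => /(_ _) H.
apply: (le_trans (H _)).
  by move=> y y0; rewrite mulmxA; apply: mx_deriv_withinMr; exact: dW.
move: (W x *m _) => u; rewrite -[X in _ <= sq X]vsubmxK sq_col_mx.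
by have := sq_ge0 (dsubmx u); lra.
Qed.

Lemma unitmx_inj n (B : 'M[C]_n) :
  (forall f : 'cV[C]_n, B *m f = 0 -> f = 0) -> B \in unitmx.
Proof.
move=> Binj; rewrite -unitmx_tr -row_free_unit; apply: inj_row_free => w wB.
apply: trmx_inj; rewrite trmx0; apply: Binj.
by apply: trmx_inj; rewrite trmx_mul trmxK wB trmx0.
Qed.

End DiracUniqueness.

(** * The evolution of the Weyl function *)

Theorem theorem3p2 (R : realType) (p : nat) (a M : R)
    (v vx vt vxx vxxx : R -> R -> 'M[R[i]]_p)
    (phi : R -> R[i] -> 'M[R[i]]_p)
    (Rm : R -> R[i] -> 'M[R[i]]_(p + p)) :
  let D := [set q : R * R | 0 <= q.1 /\ 0 <= q.2 < a] in
  (0 < p)%N -> 0 < a -> 0 < M ->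
  (* vx, vt, vxx and vxxx are the partial derivatives of v on D *)
  (forall x t, D (x, t) ->
    [/\ mx_deriv_within `[0, +oo[ (v^~ t) x (vx x t),
        mx_deriv_within `[0, a[ (v x) t (vt x t),
        mx_deriv_within `[0, +oo[ (vx^~ t) x (vxx x t) &
        mx_deriv_within `[0, +oo[ (vxx^~ t) x (vxxx x t)]) ->
  (* v is of class C^1 on D and vxx is continuous on D *)
  mx_continuous_within D v ->
  mx_continuous_within D vx ->
  mx_continuous_within D vt ->
  mx_continuous_within D vxx ->
  (* the matrix focusing mKdV equation *)
  (forall x t, D (x, t) ->
    4 *: vt x t = vxxx x t + 3 *: (vx x t *m (v x t)^t* *m v x t
                                   + v x t *m (v x t)^t* *m vx x t)) ->
  (forall x t, D (x, t) -> opnorm (v x t) <= M) ->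
  (exists K : R, forall x t, D (x, t) ->
    opnorm (vx x t) + opnorm (vxx x t) <= K) ->
  (forall t, 0 <= t < a -> is_weyl_function M (v^~ t) (phi t)) ->
  (forall z, complex.Im z < - M ->
    Rm 0 z = 1%:M /\
    forall t, 0 <= t < a ->
      mx_deriv_within `[0, a[ (Rm^~ z) t
        (Fmx (v 0 t) (vx 0 t) (vxx 0 t) z *m Rm t z)) ->
  forall t z, 0 <= t < a -> complex.Im z < - M ->
    dlsubmx (Rm t z) *m phi 0 z + drsubmx (Rm t z) \in unitmx /\
    phi t z = (ulsubmx (Rm t z) *m phi 0 z + ursubmx (Rm t z)) *m
              invmx (dlsubmx (Rm t z) *m phi 0 z + drsubmx (Rm t z)).
Proof.
move=> D _ a0 M0 v_derivs cv _ cvt _ mkdv vM [K vK] weyl RmP t z ta zM.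
have [Rm0 dRm] := RmP z zM.
pose H s : 'M[R[i]]_(p + p, p) := col_mx (phi s z) 1%:M.
(* Outside [0, a) the constant 1 serves as a placeholder; this makes the
   formula Y 0 r = Rm r z H(0) hold for all r. *)
have ex_W s : exists W : R -> 'M[R[i]]_(p + p), W 0 = 1%:M /\
    (0 <= s < a -> is_fundamental_solution (v^~ s) z W /\
                   integrable_halfline (fun x => sq (W x *m H s))).
  have [sa|] := boolP (0 <= s < a); last by exists (fun=> 1%:M).
  have [W WP Wi] := weyl s sa z zM; exists W; split; first by case: WP.
  split=> //; apply: integrable_halfline_sq.
  rewrite (_ : (fun _ => _) = fun x =>
    row_mx ((phi s z)^t*) 1%:M *m (W x)^t* *m W x *m col_mx (phi s z) 1%:M) //.
  apply/funext => x; rewrite ctrM !mulmxA; congr (_ *m _ *m _ *m _).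
  by rewrite /H tr_col_mx map_row_mx trmx1 map_mx1.
have [W WP] := choice ex_W.
pose Y x s := W s x *m (Rm s z *m H 0).
have inD x s : 0 <= x -> 0 <= s < a -> D (x, s) by split.
have zero_in : (0 : R) <= 0 < a by rewrite a0 andbT.
have v_bd : sq_bounded D (fun q => v q.1 q.2).
  by exists (M ^+ 2 * sq (1%:M : 'M[R[i]]_p)) => -[x s] Dxs; apply/opnorm_sq_le/vM.
have vx_bd : sq_bounded D (fun q => vx q.1 q.2).
  exists (K ^+ 2 * sq (1%:M : 'M[R[i]]_p)) => -[x s] Dxs; apply: opnorm_sq_le.
  by apply: le_trans (vK x s Dxs); rewrite lerDl opnorm_ge0.
have vxx_bd : sq_bounded D (fun q => vxx q.1 q.2).
  exists (K ^+ 2 * sq (1%:M : 'M[R[i]]_p)) => -[x s] Dxs; apply: opnorm_sq_le.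
  by apply: le_trans (vK x s Dxs); rewrite lerDr opnorm_ge0.
have F_bd := sq_bounded_Fmx z v_bd vx_bd vxx_bd.
have Y_x x s : D (x, s) ->
    mx_deriv_within `[0, +oo[ (Y^~ s) x (Gmx (v x s) z *m Y x s).
  move=> [/= x0 sa]; rewrite mulmxA; apply: mx_deriv_withinMr.
  by have [_ /(_ sa)[[_ dW] _]] := WP s; exact: dW.
have Y_t0 s : 0 <= s < a -> mx_deriv_within `[0, a[ (Y 0) s
    (Fmx (v 0 s) (vx 0 s) (vxx 0 s) z *m Y 0 s).
  move=> sa; have -> : Y 0 = fun r => Rm r z *m H 0.
    by apply/funext => r; rewrite /Y; have [-> _] := WP r; rewrite mul1mx.
  by rewrite mulmxA; apply: mx_deriv_withinMr; exact: dRm.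
have [L growth] := Y_time_growth v_derivs cv cvt mkdv
  (sq_bounded_Gmx z v_bd) F_bd Y_x Y_t0 ta.
have Y0E x : Y x 0 = W 0 x *m H 0 by rewrite /Y Rm0 mul1mx.
have [_ /(_ zero_in)[_ int0]] := WP 0.
have [_ /(_ ta)[Wt intt]] := WP t.
have vMt x : 0 <= x -> opnorm (v x t) <= M by move=> x0; apply: vM; exact: inD.
set A := ulsubmx _ *m _ + _; set B := dlsubmx _ *m _ + _.
have RH : Rm t z *m H 0 = col_mx A B.
  by rewrite -[Rm t z]submxK mul_block_col !mulmx1.
have B_unit : B \in unitmx.
  apply: unitmx_inj => f Bf.
  (* Y(., t) f is square integrable and starts at col (A f, B f). *)
  have Af : A *m f = 0.
    apply: (decaying_solution_eq0 M0 zM vMt Wt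
      (integrable_halflineZ (L * sq f) int0)) => x x0.
    rewrite -{1}Bf -mul_col_mx -RH mulmxA -/(Y x t).
    apply: le_trans (sqM_le _ _) _; rewrite -Y0E mulrAC ler_wpM2r ?sq_ge0//.
    exact: growth.
  (* Rm t z (H 0 f) = 0, and solutions of the t-system vanish at time 0 if
     they vanish at time t. *)
  have RHf : Rm t z *m (H 0 *m f) = 0 by rewrite mulmxA RH mul_col_mx Af Bf col_mx0.
  have [t0 ta'] := andP ta; have [KF FK] := F_bd.
  have sub : `[0, t] `<=` `[0, a[.
    by move=> y /=; rewrite !in_itv/= => /andP[-> yt]; exact: le_lt_trans yt ta'.
  have := @sq_linear_ode_ge _ 0 t _ _ (fun s => Rm s z *m (H 0 *m f))
    (fun s => Fmx (v 0 s) (vx 0 s) (vxx 0 s) z) KF t0.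
  rewrite RHf sq0 mulr0 Rm0 mul1mx => /(_ _ _) Hf.
  have {}Hf : sq (H 0 *m f) <= 0.
    apply: Hf => s st.
      rewrite mulmxA; apply: (mx_deriv_withinS sub); apply: mx_deriv_withinMr.
      by apply: dRm; move/sub: st; rewrite /= in_itv.
    by apply: (FK (0, s)); apply: inD => //; move/sub: st; rewrite /= in_itv.
  have := sq_eq0 Hf; rewrite mul_col_mx mul1mx => /(congr1 dsubmx).
  by rewrite col_mxKd linear0.
split=> //; apply/eqP; rewrite eq_sym -subr_eq0; apply/eqP.
apply: (decaying_solution_eq0 M0 zM vMt Wt (integrable_halflineD
  (integrable_halflineZ (2 * (L * sq (invmx B))) int0)
  (integrable_halflineZ 2 intt))) => x x0.
(* Y(., t) B^-1 starts at col (A B^-1, 1), and W H(t) at col (phi(t), 1): their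
   difference is square integrable and starts at col (A B^-1 - phi(t), 0). *)
have -> : col_mx (A *m invmx B - phi t z) 0 = Rm t z *m H 0 *m invmx B - H t.
  by rewrite RH mul_col_mx mulmxV// /H opp_col_mx add_col_mx subrr.
rewrite mulmxBr mulmxA -/(Y x t); apply: le_trans (sqD_le _ _) _.
rewrite sqN lerD2r -mulrA ler_wpM2l// -Y0E.
apply: le_trans (sqM_le _ _) _; rewrite mulrAC ler_wpM2r ?sq_ge0//.
exact: growth.
Qed.
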